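(* For $N\in\mathbb{N}$, the operator $\mathcal{L}_p=\mathcal{L}_p(x;\beta;N)$ is self-adjoint with respect to the Racah inner product, i.e. $\langle\mathcal{L}_pf,g\rangle=\langle f,\mathcal{L}_pg\rangle$ for all $f,g\in\mathcal{P}_\lambda^N$.
   Context: Notation: $p\ge1$, $x=(x_1,\dots,x_p)$, $\beta=(\beta_0,\dots,\beta_{p+1})\in\mathbb{R}^{p+2}$. Put $\lambda_i=x_i(x_i+\beta_i)$ for $1\le i\le p$, $\mathcal{P}_\lambda=\mathbb{R}[\lambda_1,\dots,\lambda_p]\subset\mathbb{R}[x_1,\dots,x_p]$, and let $\mathcal{P}_\lambda^d$ be the space of elements of $\mathcal{P}_\lambda$ of total degree at most $d$ in $\lambda_1,\dots,\lambda_p$. The operator $\mathcal{L}_p$: $E_{x_i}$ is the shift $f(x)\mapsto f(x+e_i)$, $\triangle_{x_i}=E_{x_i}-1$, $\nabla_{x_i}=1-E_{x_i}^{-1}$, with multi-index notation $\triangle_x^\mu=\prod_j\triangle_{x_j}^{\mu_j}$, $\nabla_x^\mu=\prod_j\nabla_{x_j}^{\mu_j}$. Let $I_i$ be the substitution $x_i\mapsto -x_i-\beta_i$ (other variables fixed) on rational functions. For $\nu\in\{0,1\}^p\setminus\{0\}$ with nonzero components at positions $i_1<\cdots<i_s$ put $$A_\nu=(x_{i_1}+\beta_{i_1}-\beta_0)(x_{i_1}+\beta_{i_1})\,\frac{\prod_{k=2}^s(x_{i_k}+x_{i_{k-1}}+\beta_{i_k})(x_{i_k}+x_{i_{k-1}}+\beta_{i_k}+1)}{\prod_{k=1}^s(2x_{i_k}+\beta_{i_k})(2x_{i_k}+\beta_{i_k}+1)}\,(x_{i_s}+\beta_{p+1}+N)(N-x_{i_s}).$$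 For $\nu\in\mathbb{Z}^p$ put $\nu_j^+=\max(\nu_j,0)$, $\nu_j^-=-\min(\nu_j,0)$. For $\nu\in\{-1,0,1\}^p\setminus\{0,1\}^p$ put $A_\nu=I^{\nu^-}(A_{\nu^++\nu^-})$, where $I^{\nu^-}$ is the composition of the $I_i$ with $\nu_i^-=1$. Then $$\mathcal{L}_p=\sum_{\nu\in\{-1,0,1\}^p\setminus\{0\}}(-1)^{|\nu^-|}A_\nu\,\triangle_x^{\nu^+}\nabla_x^{\nu^-}.$$ Racah inner product on $\mathcal{P}_\lambda^N$: $\langle f,g\rangle=\sum_{x\in V_N}f(x)g(x)\rho(x)$, where, with $x_0=0$ and $x_{p+1}=N$, $V_N=\{x\in\mathbb{N}_0^p: 0=x_0\le x_1\le\cdots\le x_p\le x_{p+1}=N\}$ and $$\rho(x)=\prod_{k=0}^p\frac{\Gamma(\beta_{k+1}-\beta_k+x_{k+1}-x_k)\,\Gamma(\beta_{k+1}+x_{k+1}+x_k)}{(x_{k+1}-x_k)!\,\Gamma(\beta_k+1+x_{k+1}+x_k)}\prod_{k=1}^p(\beta_k+2x_k).$$ The parameters $\beta$ are assumed to be such that $\rho$ is well defined on $V_N$ and $\langle\cdot,\cdot\rangle$ is an inner product on $\mathcal{P}_\lambda^N$. *)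

(* Defs.v *)
From mathcomp Require Import all_boot all_order all_algebra fraction.
From mathcomp Require Import mpoly.
From mathcomp Require Import boolp classical_sets reals topology normedtype.
From mathcomp Require Import sequences.
(* The notations of exp clash with those of mpoly. *)
From mathcomp Require Import -(notations) exp.

Set Implicit Arguments.
Unset Strict Implicit.
Unset Printing Implicit Defensive.

Import Order.TTheory GRing.Theory Num.Theory numFieldNormedType.Exports.

Local Open Scope classical_set_scope.
Local Open Scope ring_scope.

(* Gauss's limit n! n^z / (z (z+1) ... (z+n)), which is the Gamma function at
   every real z other than 0, -1, -2, ...  At these poles the sequence is
   eventually 0 (since 0^-1 = 0), so that Gamma z = 0 there and (Gamma z)^-1 is
   the entire function 1/Gamma at every real z. *)
Definition Gamma (R : realType) (z : R) : R :=
  lim ((fun n : nat =>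
    n`!%:R * powR n%:R z / \prod_(k < n.+1) (z + k%:R)) @ \oo).

Definition Gamma_pole (R : realType) (z : R) : Prop :=
  exists m : nat, z = - m%:R.

Definition is_inner_product_on (R : realType) (V : lmodType R) (S : V -> Prop)
    (ip : V -> V -> R) : Prop :=
  [/\ forall f g, S f -> S g -> ip f g = ip g f,
      forall (a : R) f g h, S f -> S g -> S h ->
        ip (a *: f + g) h = a * ip f h + ip g h
    & forall f, S f -> f != 0 -> 0 < ip f f].

(* The variable x_j (1 <= j <= p) is indexed by i : 'I_p with i + 1 = j, so the
   parameter attached to the variable of index i is bpar beta i.+1. *)
Definition bpar (R : realType) (p : nat) (beta : 'I_p.+2 -> R) (k : nat) : R :=
  beta (inord k).

Section Polynomials.
Context {R : realType} {p : nat} (beta : 'I_p.+2 -> R).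

Definition lam (i : 'I_p) : {mpoly R[p]} :=
  'X_i * ('X_i + (bpar beta i.+1)%:MP).

(* msize is the total degree plus one (and 0 for the zero polynomial). *)
Definition P_lam (d : nat) (f : {mpoly R[p]}) : Prop :=
  exists2 q : {mpoly R[p]}, (msize q <= d.+1)%N & f = q \mPo [tuple lam i | i < p].

End Polynomials.

Section InnerProduct.
Context {R : realType} {p : nat} (beta : 'I_p.+2 -> R) (N : nat).

Local Notation b := (bpar beta).

(* Points of V_N have all their coordinates in {0, ..., N}.  xcoord x k is x_k
   for 0 <= k <= p+1, with x_0 = 0 and x_(p+1) = N. *)
Definition xcoord (x : {ffun 'I_p -> 'I_N.+1}) (k : nat) : nat :=
  if k is k'.+1 then (if insub k' is Some i then x i : nat else N) else 0%N.

Definition V_N : {set {ffun 'I_p -> 'I_N.+1}} :=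
  [set x | [forall k : 'I_p.+1, xcoord x k <= xcoord x k.+1]%N].

Definition rho (x : {ffun 'I_p -> 'I_N.+1}) : R :=
  let X k : R := (xcoord x k)%:R in
  (\prod_(k < p.+1)
     (Gamma (b k.+1 - b k + X k.+1 - X k) * Gamma (b k.+1 + X k.+1 + X k)
      / ((xcoord x k.+1 - xcoord x k)`!%:R * Gamma (b k + 1 + X k.+1 + X k))))
  * \prod_(1 <= k < p.+1) (b k + 2 * X k).

(* Nothing is required of the Gamma factors in the denominator: 1/Gamma is
   entire, and vanishes at the poles of Gamma. *)
Definition rho_well_defined : Prop :=
  forall x : {ffun 'I_p -> 'I_N.+1}, x \in V_N -> forall k : 'I_p.+1,
    let X k : R := (xcoord x k)%:R in
    ~ Gamma_pole (b k.+1 - b k + X k.+1 - X k) /\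
    ~ Gamma_pole (b k.+1 + X k.+1 + X k).

Definition racah_ip (f g : {mpoly R[p]}) : R :=
  let pt (x : {ffun 'I_p -> 'I_N.+1}) (i : 'I_p) : R := (x i : nat)%:R in
  \sum_(x in V_N) f.@[pt x] * g.@[pt x] * rho x.

End InnerProduct.

Definition ratfun (R : realType) (p : nat) := {fraction {mpoly R[p]}}.

Section RationalFunctions.
Context {R : realType} {p : nat}.

Definition polyF (f : {mpoly R[p]}) : ratfun R p := FracField.tofrac f.

Definition cstF (c : R) : ratfun R p := polyF c%:MP.

Definition XF (i : 'I_p) : ratfun R p := polyF 'X_i.

(* Substitution x_i |-> s i in a rational function, computed on a chosen
   numerator and denominator. It is only used below for invertible affine s,
   for which the result does not depend on that choice. *)
Definition substF (s : 'I_p -> ratfun R p) (r : ratfun R p) : ratfun R p :=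
  mmap cstF s (\n_(repr r)) / mmap cstF s (\d_(repr r)).

Definition subst1 (i : 'I_p) (u : ratfun R p) (r : ratfun R p) : ratfun R p :=
  substF (fun j => if j == i then u else XF j) r.

Definition shiftF (i : 'I_p) := subst1 i (XF i + 1).
Definition shiftVF (i : 'I_p) := subst1 i (XF i - 1).

Definition fdiff (i : 'I_p) (r : ratfun R p) : ratfun R p := shiftF i r - r.
Definition bdiff (i : 'I_p) (r : ratfun R p) : ratfun R p := r - shiftVF i r.

(* T_1^(mu_1) o ... o T_p^(mu_p); it is only used for commuting families T. *)
Definition multipow (T : 'I_p -> ratfun R p -> ratfun R p) (mu : 'I_p -> nat)
    (r : ratfun R p) : ratfun R p :=
  foldr (fun i => iter (mu i) (T i)) r (enum 'I_p).

End RationalFunctions.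

Section Operator.
Context {R : realType} {p : nat} (beta : 'I_p.+2 -> R) (N : nat).

Local Notation b k := (cstF (bpar beta k) : ratfun R p).
Local Notation x := (@XF R p).

Definition reflF (i : 'I_p) := subst1 i (- x i - b i.+1).

(* A_mu for mu in {0,1}^p \ {0}, i1 :: t being the increasing list of the
   positions of the nonzero components; the value for mu = 0 is never used. *)
Definition A_pos (mu : 'I_p -> nat) : ratfun R p :=
  if [seq i <- enum 'I_p | mu i != 0%N] is i1 :: t then
    let l := last i1 t in
    (x i1 + b i1.+1 - b 0) * (x i1 + b i1.+1)
    * ((\prod_(q <- zip (i1 :: t) t)
          ((x q.2 + x q.1 + b q.2.+1) * (x q.2 + x q.1 + b q.2.+1 + 1)))
       / (\prod_(i <- i1 :: t)
          ((2 * x i + b i.+1) * (2 * x i + b i.+1 + 1))))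
    * ((x l + b p.+1 + N%:R) * (N%:R - x l))
  else 0.

(* {-1,0,1}^p is encoded as {ffun 'I_p -> 'I_3}, with nu_i = nu i - 1. *)
Definition sval3 (nu : {ffun 'I_p -> 'I_3}) (i : 'I_p) : int :=
  (nu i : nat)%:Z - 1.

Definition ppart (nu : {ffun 'I_p -> 'I_3}) (i : 'I_p) : nat :=
  `|Num.max (sval3 nu i) 0|%N.

Definition npart (nu : {ffun 'I_p -> 'I_3}) (i : 'I_p) : nat :=
  `|- Num.min (sval3 nu i) 0|%N.

Definition A_coef (nu : {ffun 'I_p -> 'I_3}) : ratfun R p :=
  multipow reflF (npart nu) (A_pos (fun i => ppart nu i + npart nu i)%N).

Definition L_op (r : ratfun R p) : ratfun R p :=
  \sum_(nu : {ffun 'I_p -> 'I_3} | [exists i, sval3 nu i != 0])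
    (-1) ^+ (\sum_(i < p) npart nu i)%N * A_coef nu
    * multipow fdiff (ppart nu) (multipow bdiff (npart nu) r).

End Operator.

(* Main.v *)
Require Import Defs.
From mathcomp Require Import all_boot all_order all_algebra fraction.
From mathcomp Require Import generic_quotient.
From mathcomp Require Import mpoly.
From mathcomp Require Import boolp classical_sets reals topology normedtype.
From mathcomp Require Import sequences.
From mathcomp Require Import -(notations) exp.
From mathcomp Require Import ring lra zify.

Set Implicit Arguments.
Unset Strict Implicit.
Unset Printing Implicit Defensive.

Import Order.TTheory GRing.Theory Num.Theory numFieldNormedType.Exports.

Local Open Scope ring_scope.

(** Why the operator is self-adjoint.

    Write sigma_i for the reflection x_i |-> - x_i - beta_i. It fixes every
    lambda_j, and conversely a polynomial fixed by all the reflections is a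
    polynomial in the lambdas (invariant_P_lam). On such an f the summand of
    L_p f with index nu is the image under the reflections of the summand with
    index |nu|, up to the sign in front. A difference in the direction i
    of a sigma_i-invariant polynomial is divisible by 2 x_i + beta_i + 1, which
    cancels one half of the denominator of A_nu; what remains is
    D = prod_i (2 x_i + beta_i), and the numerator of L_p f over D is
    anti-invariant, hence divisible by D. So L_p f is an invariant polynomial,
    and counting degrees keeps it in P_lambda^N (operator_polynomial,
    L_op_numerators).

    For the symmetry, L_p is rewritten as sum_nu C_nu E^nu - const, with E^nu
    the shift by nu, where C_nu is a product over k of a weight that depends
    only on x_k, x_(k+1), nu_k, nu_(k+1). Expanding shifts into differences,
    the coefficient of the difference indexed by nu is the sum of C_mu over
    the mu that extend nu, and this sum collapses to A_nu by a transfer-matrix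
    identity (bond_trans): summing the product of two adjacent weights over the
    sign at the middle site gives the weight between the outer ones. The
    resulting formula for L_p f at a lattice point is quotient_eval.

    The product form makes the rest local. C_nu(x) vanishes when x + nu leaves
    V_N (shift_coef_target), and rho(x) C_nu(x) = rho(x + nu) C_(-nu)(x + nu)
    holds factor by factor, from Gamma(z + 1) = z Gamma(z)
    (rho_factor_balance, detailed_balance). Hence <L_p f, g> + const <f, g> is
    a sum over pairs of points of V_N with a symmetric kernel.

    Evaluating the rational functions A_nu at lattice points needs nonzero
    denominators. Positivity of the form provides them: it forces the values of
    each lambda_k on 0, ..., N to be distinct and rho to be nonzero on V_N
    (lam_at_inj, rho_neq0, regular_site). One degeneracy survives, namely
    beta_k = 1 at x_k = 0; there the weights of C_nu are replaced by their
    limits in beta (step). *)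

(** * Signs, bonds and their transfer identity *)

Definition neg3 : 'I_3 := @Ordinal 3 0 isT.
Definition nul3 : 'I_3 := @Ordinal 3 1 isT.
Definition pos3 : 'I_3 := @Ordinal 3 2 isT.

Lemma sign3P (P : 'I_3 -> Prop) : P neg3 -> P nul3 -> P pos3 -> forall c, P c.
Proof.
move=> Pn P0 Pp [[|[|[|//]]] i].
- by rewrite (_ : Ordinal i = neg3) //; apply: val_inj.
- by rewrite (_ : Ordinal i = nul3) //; apply: val_inj.
- by rewrite (_ : Ordinal i = pos3) //; apply: val_inj.
Qed.

Lemma big_sign3 (A : nmodType) (F : 'I_3 -> A) :
  \sum_c F c = F neg3 + F nul3 + F pos3.
Proof.
rewrite !big_ord_recl big_ord0 addr0 addrA.
by congr (_ + _ + _); congr F; apply: val_inj.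
Qed.

Section Weights.
Context {A : comNzRingType}.
Implicit Types (a c : 'I_3) (b y z : A).

Definition sgn3 c : A := (c : nat)%:R - 1.

(** The coordinate at which a factor of A_nu is read: the reflection is
    applied exactly at the sites where nu is negative. *)
Definition mirror c b y : A := if c == neg3 then - y - b else y.

(** The factor that two consecutive sites, at coordinates y and z with
    signs a and c, contribute to the numerator of the shift coefficients. When
    both signs are nonzero, or when the site with sign 0 is one of the two ends
    of the chain, it is the corresponding factor of A_nu. Entries with right
    sign 0 carry a factor 2, which keeps the (0, 0) entry integral; since every
    chain ends with sign 0, the operator described below is 2 L_p. *)
Definition bond a c y b z b' : A :=
  let y' := mirror a b y in let z' := mirror c b' z in
  match a == nul3, c == nul3 with
  | true, true => 2 * (y * (y + b) + z * (z + b')) + (b + 1) * (b' - 1)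
  | true, false => (z' + y + b') * (z' - y + b' - b)
  | false, true => 2 * ((z - y') * (z + y' + b'))
  | false, false => (z' + y' + b') * (z' + y' + b' + 1)
  end.

Definition denom c y b : A :=
  let y' := mirror c b y in
  if c == nul3 then (2 * y + b) ^+ 2 - 1 else (2 * y' + b) * (2 * y' + b + 1).

End Weights.

(** Negative signs reduce to positive ones at mirrored coordinates,
    so that identities between bonds need only be checked for signs 0 and 1. *)
Lemma bond_mirror (A : comNzRingType) (a c : 'I_3) (y b z b' : A) :
  let m (s : 'I_3) := if s == nul3 then nul3 else pos3 in
  bond a c y b z b' = bond (m a) (m c) (mirror a b y) b (mirror c b' z) b'.
Proof.
elim/sign3P: a; elim/sign3P: c; rewrite /bond /mirror /=; ring.
Qed.

(** The transfer identity: a middle site can be integrated out.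
    After mirroring the outer coordinates it is a rational identity for each of
    the four pairs of signs in {0, 1}. *)
Lemma bond_trans (F : fieldType) (a d : 'I_3) (y b x b' z b'' : F) :
  (forall c, denom c x b' != 0) ->
  \sum_c bond a c y b x b' / denom c x b' * bond c d x b' z b''
  = bond a d y b z b''.
Proof.
move=> nz; rewrite big_sign3.
have := nz neg3; have := nz nul3; have := nz pos3.
rewrite /denom /mirror /= => hp h0 hn.
have e0 : 2 * (- x - b') + b' = - (2 * x + b') by ring.
have h1 : 2 * x + b' != 0 by move: hp; rewrite mulf_eq0 negb_or => /andP[].
have h2 : 2 * x + b' + 1 != 0 by move: hp; rewrite mulf_eq0 negb_or => /andP[].
have h4 : 2 * (- x - b') + b' + 1 != 0 by move: hn; rewrite mulf_eq0 negb_or => /andP[].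
suff key s t u v : (s != neg3) -> (t != neg3) ->
    bond s neg3 u b x b' / denom neg3 x b' * bond neg3 t x b' v b'' +
    bond s nul3 u b x b' / denom nul3 x b' * bond nul3 t x b' v b'' +
    bond s pos3 u b x b' / denom pos3 x b' * bond pos3 t x b' v b''
    = bond s t u b v b''.
  pose m (s : 'I_3) := if s == nul3 then nul3 else pos3.
  have hm s : m s != neg3 by rewrite /m; case: ifP.
  have e : forall c, bond a c y b x b' = bond (m a) c (mirror a b y) b x b'.
    move=> c; rewrite bond_mirror [RHS]bond_mirror -/(m c) -/(m (m a)) -/(m a).
    by rewrite {1 3}/m; elim/sign3P: (a).
  have e' : forall c, bond c d x b' z b'' = bond c (m d) x b' (mirror d b'' z) b''.
    move=> c; rewrite bond_mirror [RHS]bond_mirror -/(m c) -/(m (m d)) -/(m d).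
    by rewrite {2 4}/m; elim/sign3P: (d).
  rewrite !e !e' key // -/(m _).
  by rewrite [RHS]bond_mirror.
elim/sign3P: s => // _; elim/sign3P: t => // _;
  rewrite /bond /denom /mirror /=; field;
  by rewrite h1 h2 h0 h4 e0 oppr_eq0 h1.
Qed.

(** * Sums over chains of sites *)

Section Chains.
Context {I : finType} {F : comNzRingType} {T M : Type}.
Variables (wt : I -> 'I_3 -> T -> F) (next : I -> 'I_3 -> T -> T).
Variables (last : T -> F) (op : I -> 'I_3 -> M -> M) (ev : M -> F).
Implicit Types (nu : {ffun I -> 'I_3}) (s : seq I).

(** A chain visits the sites of s in order. Its current state of type
    T records the last site that matters for the next weight, which is the
    previous site for the shift coefficients and the previous site with nonzero
    sign for the coefficients A_nu. *)
Fixpoint chain_wt nu s t : F :=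
  if s is i :: s' then wt i (nu i) t * chain_wt nu s' (next i (nu i) t)
  else last t.

Fixpoint chain_op nu s h : M :=
  if s is i :: s' then chain_op nu s' (op i (nu i) h) else h.

Fixpoint chain_sum s t h : F :=
  if s is i :: s' then \sum_c wt i c t * chain_sum s' (next i c t) (op i c h)
  else last t * ev h.

Definition supported s nu := [forall j, (j \notin s) ==> (nu j == nul3)].

Definition update i c nu : {ffun I -> 'I_3} :=
  [ffun j => if j == i then c else nu j].

Lemma update_id i nu : update i (nu i) nu = nu.
Proof. by apply/ffunP => j; rewrite ffunE; case: eqP => [->|]. Qed.

Lemma update_update i c d nu : update i c (update i d nu) = update i c nu.
Proof. by apply/ffunP => j; rewrite !ffunE; case: eqP. Qed.

Lemma chain_wt_update i c nu s t : i \notin s ->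
  chain_wt (update i c nu) s t = chain_wt nu s t.
Proof.
elim: s t => //= j s IH t; rewrite inE negb_or => /andP[nij nis].
by rewrite ffunE eq_sym (negPf nij) IH.
Qed.

Lemma chain_op_update i c nu s h : i \notin s ->
  chain_op (update i c nu) s h = chain_op nu s h.
Proof.
elim: s h => //= j s IH h; rewrite inE negb_or => /andP[nij nis].
by rewrite ffunE eq_sym (negPf nij) IH.
Qed.

Lemma sum_supported_cons (Phi : {ffun I -> 'I_3} -> F) i s : i \notin s ->
  \sum_(nu | supported (i :: s) nu) Phi nu
  = \sum_c \sum_(nu | supported s nu) Phi (update i c nu).
Proof.
move=> nis; rewrite (partition_big (fun nu => nu i) predT) //=.
apply: eq_bigr => c _.
rewrite (reindex_onto (update i c) (update i nul3)) /=; last first.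
  by move=> nu /andP[_ /eqP <-]; rewrite update_update update_id.
apply: eq_bigl => nu; rewrite !ffunE eqxx update_update eqxx andbT.
apply/andP/forallP => [[/forallP sup /eqP <-] j|sup].
  apply/implyP => njs; rewrite ffunE; case: (j =P i) => // /eqP nji.
  by have := sup j; rewrite inE negb_or nji njs ffunE (negPf nji).
split; last first.
  apply/eqP/ffunP => j; rewrite ffunE; case: eqP => // ->.
  by apply/esym/eqP; have := sup i; rewrite nis.
apply/forallP => j; rewrite inE negb_or; apply/implyP => /andP[nji njs].
by rewrite ffunE (negPf nji); have := sup j; rewrite njs.
Qed.

(** The nested sum, one site at a time, lends itself to induction on
    the sites, the flat one to reindexing over all nu. *)
Lemma chain_sumE s t h : uniq s ->
  chain_sum s t h
  = \sum_(nu | supported s nu) chain_wt nu s t * ev (chain_op nu s h).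
Proof.
elim: s t h => [|i s IH] t h /=.
  move=> _; rewrite (big_pred1 [ffun=> nul3]) // => nu.
  apply/forallP/eqP => [sup|-> j]; last by rewrite ffunE eqxx implybT.
  by apply/ffunP => j; rewrite ffunE; have /eqP := sup j.
case/andP => nis us; rewrite sum_supported_cons //; apply: eq_bigr => c _.
rewrite IH // big_distrr; apply: eq_bigr => nu _ /=.
by rewrite ffunE eqxx mulrA chain_wt_update // chain_op_update.
Qed.

End Chains.

(** * From differences to shifts *)

Section Transfer.
Context {I : finType} {F : fieldType} {M : zmodType}.
Variables (X : I -> nat) (beta : I -> F) (N : nat) (betaN : F).
Variables (E : I -> 'I_3 -> {additive M -> M}) (ev : {additive M -> F}).
Hypothesis E_nul : forall i h, E i nul3 h = h.
Hypothesis regular : forall i,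
  (2 * (X i)%:R + beta i != 0) && (2 * (X i)%:R + beta i + 1 != 0)
  && ((0 < X i)%N ==> (2 * (X i)%:R + beta i - 1 != 0)).

Local Notation site := ('I_3 * nat * F)%type.

Definition site_last (t : site) : F :=
  bond t.1.1 nul3 t.1.2%:R t.2 N%:R betaN.

(** The weight from the site t to the site u, which need not be adjacent:
    the sites skipped in between have sign 0. *)
Definition hop (t u : site) : F :=
  bond t.1.1 u.1.1 t.1.2%:R t.2 u.1.2%:R u.2 / denom u.1.1 u.1.2%:R u.2.

(** The weight between adjacent sites. If the coordinate of u is 0, so is
    that of t, and for parameter b' = 1 at u the denominators of hop vanish for
    the signs 0 and -1 of u. In that corner hop has numerator 0 for the sign
    -1; for the sign 0 it is ((b + 1)(b' - 1)) / ((b' + 1)(b' - 1)) or 0,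
    according as t has sign 0 or 1, and cancelling b' - 1 keeps it regular at
    b' = 1. *)
Definition step (t u : site) : F :=
  if (u.1.2 == 0)%N && (u.1.1 != pos3) then
    if (u.1.1 == nul3) && (t.1.1 == nul3) then (t.2 + 1) / (u.2 + 1) else 0
  else hop t u.

(** In a chain that starts at an admissible site, a sign -1 at
    coordinate 0 is reached with weight 0, so admissibility propagates along
    all the chains that matter. *)
Definition admissible (t : site) := (t.1.2 == 0)%N ==> (t.1.1 != neg3).

Local Notation at_ i c := ((c, X i, beta i) : site).

(** The only site at which the denominator of A_nu may vanish is
    a negative sign at coordinate 0, and there the numerator vanishes as well,
    because the coordinates before it are 0 too. *)
Lemma bond_neg0 i t : admissible t -> (t.1.2 <= X i)%N -> X i = 0%N ->
  bond t.1.1 neg3 t.1.2%:R t.2 (X i)%:R (beta i) = 0.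
Proof.
case: t => [[a y] b]; rewrite /admissible /= => ok + x0.
rewrite x0 leqn0 => /eqP y0; move: ok; rewrite y0 /=.
by elim/sign3P: a => //= _; rewrite /bond /mirror /=; ring.
Qed.

(** The transfer identity survives the modification of the weights
    in the corner: there the sign -1 contributes 0 on the left. *)
Lemma step_trans i t d z b : admissible t -> (t.1.2 <= X i)%N ->
  \sum_c step t (at_ i c) * bond c d (X i)%:R (beta i) z b
  = bond t.1.1 d t.1.2%:R t.2 z b.
Proof.
case: t => [[a y] b0]; rewrite /admissible /= => ok le_yx.
have /andP[/andP[h1 h2] h3] := regular i.
have [x0|xn0] := eqVneq (X i) 0%N; last first.
  rewrite -(@bond_trans _ a d _ _ (X i)%:R (beta i)).
    by apply: eq_bigr => c _; rewrite /step /hop /= (negPf xn0).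
  move: h3; rewrite lt0n xn0 /= => h3.
  elim/sign3P; rewrite /denom /mirror /=.
  - rewrite (_ : _ * _ = (2 * (X i)%:R + beta i) * (2 * (X i)%:R + beta i - 1));
      last by ring.
    by rewrite mulf_neq0.
  - rewrite (_ : _ - 1 = (2 * (X i)%:R + beta i + 1) * (2 * (X i)%:R + beta i - 1));
      last by ring.
    by rewrite mulf_neq0.
  - by rewrite mulf_neq0.
have y0 : y = 0%N by apply/eqP; rewrite -leqn0 -x0.
move: ok h1 h2; rewrite big_sign3 /step /hop y0 x0 /= => ok h1 h2.
have h1' : beta i != 0 by move: h1; rewrite mulr0 add0r.
have h2' : beta i + 1 != 0 by move: h2; rewrite mulr0 add0r.
by move: ok; elim/sign3P: a => //= _; elim/sign3P: d; rewrite /bond /denom /mirror /=;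
  rewrite ?mulr0 ?add0r ?mul0r; field; rewrite ?h1' ?h2'.
Qed.

Definition hop_wt i c t : F := if c == nul3 then 1 else hop t (at_ i c).
Definition hop_next i c t : site := if c == nul3 then t else at_ i c.
Definition hop_op i c h : M := if c == nul3 then h else E i c h - h.
Definition step_wt i c t : F := step t (at_ i c).
Definition step_next i c (t : site) : site := at_ i c.

Local Notation hop_sum := (@chain_sum I F site M hop_wt hop_next site_last hop_op ev).
Local Notation step_sum :=
  (@chain_sum I F site M step_wt step_next site_last (fun i c => E i c) ev).

Lemma hop_sumD s t h1 h2 : hop_sum s t (h1 + h2) = hop_sum s t h1 + hop_sum s t h2.
Proof.
elim: s t h1 h2 => [|i s IH] t h1 h2 /=; first by rewrite raddfD mulrDr.
rewrite -big_split; apply: eq_bigr => c _ /=; rewrite -mulrDr -IH.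
by congr (_ * chain_sum _ _ _ _ _ _ _ _); rewrite /hop_op; case: ifP => // _;
  rewrite raddfD opprD addrACA.
Qed.

Lemma hop_sum0 s t : hop_sum s t 0 = 0.
Proof. by apply: (addrI (hop_sum s t 0)); rewrite -hop_sumD !addr0. Qed.

Lemma hop_sum_cons i s t h :
  hop_sum (i :: s) t h = hop_sum s t h
    + \sum_(c | c != nul3) hop t (at_ i c) * hop_sum s (at_ i c) (E i c h - h).
Proof.
rewrite /= (bigD1 nul3) //= /hop_wt /hop_next /hop_op eqxx mul1r; congr (_ + _).
by apply: eq_bigr => c /negPf ->.
Qed.

(** Hopping sums depend on their starting site only through a
    bond, so the transfer identity removes a site of weight step. *)
Lemma hop_sum_step i s t h : admissible t -> (t.1.2 <= X i)%N ->
  \sum_c step t (at_ i c) * hop_sum s (at_ i c) h = hop_sum s t h.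
Proof.
move=> ok le_ti; elim: s h => [|j s IH] h.
  by rewrite /= /site_last /= -(step_trans _ _ _ ok le_ti) mulr_suml;
    apply: eq_bigr => c _; rewrite mulrA.
rewrite hop_sum_cons; under eq_bigr => c _ do rewrite hop_sum_cons mulrDr.
rewrite big_split /= IH; congr (_ + _).
under eq_bigr => c _ do rewrite mulr_sumr.
rewrite exchange_big /=; apply: eq_bigr => d _.
rewrite /hop -(step_trans _ _ _ ok le_ti) /= !mulr_suml; apply: eq_bigr => c _.
by rewrite !mulrA.
Qed.

(** The passage from differences to shifts: each shift is the sum of
    the identity and a difference, and by hop_sum_step the terms in which the
    identity is chosen at a site do not see that site. *)
Lemma step_sumE s t h : admissible t -> path leq t.1.2 (map X s) ->
  step_sum s t h = hop_sum s t h.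
Proof.
elim: s t h => [//|i s IH] t h ok /andP[le_ti pth].
rewrite hop_sum_cons -(hop_sum_step s h ok le_ti) /=.
(* A site that is not admissible has weight 0 and drops out of the sum. *)
have step0 c : step t (at_ i c) = 0 \/ admissible (at_ i c).
  rewrite /step_wt /step /admissible /=; case: eqP => [_|_]; last by right.
  by elim/sign3P: c; [left|right|right].
transitivity (\sum_c step t (at_ i c) * hop_sum s (at_ i c) (h + (E i c h - h))).
  apply: eq_bigr => c _; rewrite addrC subrK.
  rewrite /step_wt /step_next; have [->|okc] := step0 c; first by rewrite !mul0r.
  by rewrite IH.
transitivity (\sum_c (step t (at_ i c) * hop_sum s (at_ i c) h
    + step t (at_ i c) * hop_sum s (at_ i c) (E i c h - h))).
  by apply: eq_bigr => c _; rewrite -mulrDr -hop_sumD.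
rewrite big_split /=; congr (_ + _).
rewrite (bigD1 nul3) //= E_nul subrr hop_sum0 mulr0 add0r.
apply: eq_bigr => c nzc; congr (_ * _).
rewrite /step /=; case: ifP => // /andP[/eqP x0].
by elim/sign3P: c nzc => // _ _; rewrite /hop /= bond_neg0 // mul0r.
Qed.

End Transfer.

(** * Substitutions and degree *)

Lemma sub_mulr_factor (A : comNzRingType) (a b c e d q r : A) :
  a - b = d * q -> c - e = d * r -> a * c - b * e = d * (a * r + q * e).
Proof. by move=> Hq Hr; rewrite mulrDr mulrCA -Hr [d * (q * e)]mulrA -Hq; ring. Qed.

Local Notation psub t := (mmap (@mpolyC _ _) t).

Section Substitution.
Context {R : comNzRingType}.

Lemma mpoly_alg_ind n (P : {mpoly R[n]} -> Prop) :
  (forall c, P c%:MP) -> (forall i, P 'X_i) ->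
  (forall f g, P f -> P g -> P (f + g)) ->
  (forall f g, P f -> P g -> P (f * g)) -> forall f, P f.
Proof.
move=> PC PX PD PM f; rewrite (mpolyE f).
apply: (big_ind P) => [|g h|m _]; [by rewrite -mpolyC0|exact: PD|].
rewrite -mul_mpolyC; apply: (PM _ _ (PC _)); rewrite mpolyXE_id.
apply: (big_ind P) => [|g h|i _]; [by rewrite -mpolyC1|exact: PM|].
by elim: (m i) => [|k IH]; rewrite ?expr0 -?mpolyC1 // exprS; apply: PM.
Qed.

Lemma psubX n k (t : 'I_n -> {mpoly R[k]}) i : psub t 'X_i = t i.
Proof. by rewrite mmapX mmap1U. Qed.

Lemma psub_rmorph n k (S : comNzRingType) (phi : {rmorphism {mpoly R[k]} -> S})
    (t : 'I_n -> {mpoly R[k]}) f :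
  phi (psub t f) = mmap (phi \o @mpolyC _ _) (phi \o t) f.
Proof.
elim/mpoly_alg_ind: f => [c|i|f g IHf IHg|f g IHf IHg].
- by rewrite !mmapC.
- by rewrite psubX mmapX mmap1U.
- by rewrite !rmorphD /= IHf IHg.
- by rewrite !rmorphM /= IHf IHg.
Qed.

Lemma psub_comp n k l (t : 'I_n -> {mpoly R[k]}) (u : 'I_k -> {mpoly R[l]}) f :
  psub u (psub t f) = psub (fun i => psub u (t i)) f.
Proof.
elim/mpoly_alg_ind: f => [c|i|f g IHf IHg|f g IHf IHg].
- by rewrite !mmapC.
- by rewrite !psubX.
- by rewrite !rmorphD /= IHf IHg.
- by rewrite !rmorphM /= IHf IHg.
Qed.

Lemma psub_ext n k (t u : 'I_n -> {mpoly R[k]}) f : t =1 u -> psub t f = psub u f.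
Proof. by move=> /funext ->. Qed.

Lemma psub_id n (f : {mpoly R[n]}) : psub (fun i => 'X_i) f = f.
Proof.
elim/mpoly_alg_ind: f => [c|i|f g IHf IHg|f g IHf IHg].
- by rewrite !mmapC.
- by rewrite !psubX.
- by rewrite !rmorphD /= IHf IHg.
- by rewrite !rmorphM /= IHf IHg.
Qed.

Lemma meval_psub n k (t : 'I_n -> {mpoly R[k]}) f v :
  (psub t f).@[v] = f.@[fun i => (t i).@[v]].
Proof.
elim/mpoly_alg_ind: f => [c|i|f g IHf IHg|f g IHf IHg].
- by rewrite !mmapC !mevalC.
- by rewrite !psubX mevalXU.
- by rewrite rmorphD /= !mevalD IHf IHg.
- by rewrite rmorphM /= !mevalM IHf IHg.
Qed.

(** A divided difference: the property is clear for constants and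
    variables and passes to sums and products. *)
Lemma psub_dvd n k (t u : 'I_n -> {mpoly R[k]}) i f :
  (forall j, j != i -> t j = u j) ->
  exists q, psub t f - psub u f = (t i - u i) * q.
Proof.
move=> tu; elim/mpoly_alg_ind: f => [c|j|f g [q Hq] [r Hr]|f g [q Hq] [r Hr]].
- by exists 0; rewrite !mmapC subrr mulr0.
- rewrite !psubX; have [->|/tu ->] := eqVneq j i; first by exists 1; rewrite mulr1.
  by exists 0; rewrite subrr mulr0.
- by exists (q + r); rewrite !rmorphD /= opprD addrACA Hq Hr mulrDr.
- exists (psub t f * r + q * psub u g); rewrite !rmorphM /=.
  exact: sub_mulr_factor.
Qed.

End Substitution.

Section Degree.
Context {R : idomainType}.

Lemma msizeM_leq n (f g : {mpoly R[n]}) a b :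
  (msize f <= a.+1)%N -> (msize g <= b.+1)%N -> (msize (f * g) <= (a + b).+1)%N.
Proof.
move=> fa gb; have [->|f0] := eqVneq f 0; first by rewrite mul0r msize0.
have [->|g0] := eqVneq g 0; first by rewrite mulr0 msize0.
by rewrite msizeM //; move: fa gb; lia.
Qed.

Lemma msizeD_leq n (f g : {mpoly R[n]}) a :
  (msize f <= a)%N -> (msize g <= a)%N -> (msize (f + g) <= a)%N.
Proof. by move=> fa ga; rewrite (leq_trans (msizeD_le _ _)) // geq_max fa. Qed.

Lemma msize_sum_leq n (I : Type) (r : seq I) (P : pred I) (F : I -> {mpoly R[n]}) a :
  (forall i, P i -> (msize (F i) <= a)%N) -> (msize (\sum_(i <- r | P i) F i) <= a)%N.
Proof.
move=> Fa; apply: (big_ind (fun f : {mpoly R[n]} => (msize f <= a)%N)) => //.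
  by rewrite msize0.
by move=> f g; apply: msizeD_leq.
Qed.

Lemma msize_prod_leq n (I : Type) (r : seq I) (P : pred I) (F : I -> {mpoly R[n]})
    (a : I -> nat) :
  (forall i, P i -> (msize (F i) <= (a i).+1)%N) ->
  (msize (\prod_(i <- r | P i) F i) <= (\sum_(i <- r | P i) a i).+1)%N.
Proof.
move=> Fa; elim/big_rec2: _ => [|i f b Pi IH]; first by rewrite msize1.
exact: msizeM_leq (Fa i Pi) IH.
Qed.

Lemma msize_exp_leq n (f : {mpoly R[n]}) a k :
  (msize f <= a.+1)%N -> (msize (f ^+ k) <= (k * a).+1)%N.
Proof.
move=> fa; elim: k => [|k IH]; first by rewrite expr0 msize1.
by rewrite exprS mulSn; apply: msizeM_leq.
Qed.

Lemma msizeC_leq n (c : R) : (msize (c%:MP : {mpoly R[n]}) <= 1)%N.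
Proof. by rewrite msizeC; case: eqP. Qed.

Lemma msize_cofactor n (f g : {mpoly R[n]}) a :
  msize f = 2%N -> (msize (f * g) <= a)%N -> (msize g <= a.-1)%N.
Proof.
move=> f2; have [->|g0] := eqVneq g 0; first by rewrite msize0.
by rewrite msizeM // ?f2 -?msize_poly_eq0 ?f2 //; lia.
Qed.

Lemma msize_psub n k (t : 'I_n -> {mpoly R[k]}) d f :
  (forall i, (msize (t i) <= d.+1)%N) ->
  (msize (psub t f) <= (d * (msize f).-1).+1)%N.
Proof.
move=> td; rewrite /mmap big_seq; apply: msize_sum_leq => m mf.
rewrite mul_mpolyC (leq_trans (msizeZ_le _ _)) // /mmap1.
have := @msize_prod_leq k _ (index_enum 'I_n) predT (fun i => t i ^+ m i)
  (fun i => (m i * d)%N) (fun i _ => msize_exp_leq (m i) (td i)).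
move/leq_trans; apply.
rewrite ltnS -big_distrl /= mulnC leq_mul2l -mdegE.
by have := msize_mdeg_lt mf; case: (msize f) => //= ? /ltnSE ->; rewrite orbT.
Qed.

(** A translation does not change the top homogeneous part. The
    claim is checked on the pair of bounds (degree of g, degree of the
    difference), which is stable under products. *)
Lemma msize_psub_sub n (t : 'I_n -> {mpoly R[n]}) f :
  (forall i, (msize (t i - 'X_i) <= 1)%N) ->
  (msize (psub t f - f) <= (msize f).-1)%N.
Proof.
move=> t1; have t2 i : (msize (t i) <= 2)%N.
  by rewrite -[t i](subrK 'X_i) msizeD_leq // ?msizeX ?mdeg1 // (leq_trans (t1 i)).
have aux (g : {mpoly R[n]}) m : (msize g <= m.+1)%N -> (msize (psub t g) <= m.+1)%N.
  move=> gm; apply: leq_trans (msize_psub g t2) _; move: gm; lia.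
(* P g m bounds the degree of g by m and that of its difference by m - 1. *)
pose P g m := (msize g <= m.+1)%N && (msize (psub t g - g) <= m)%N.
have P1 : P 1 0%N by rewrite /P rmorph1 subrr msize1 msize0.
have PM g h a b : P g a -> P h b -> P (g * h) (a + b)%N.
  case/andP => ga dga /andP[hb dhb]; rewrite /P msizeM_leq //= rmorphM /=.
  rewrite (_ : _ - _ = (psub t g - g) * psub t h + g * (psub t h - h)); last by ring.
  apply: msizeD_leq.
    case: a ga dga => [|a] ga dga; last by apply: msizeM_leq; rewrite ?aux.
    move: dga; rewrite leqn0 msize_poly_eq0 => /eqP ->; by rewrite mul0r msize0.
  case: b hb dhb => [|b] hb dhb; last by rewrite addnS; apply: msizeM_leq.
  by move: dhb; rewrite leqn0 msize_poly_eq0 => /eqP ->; rewrite mulr0 msize0.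
have PX i : P 'X_i 1%N by rewrite /P psubX msizeX mdeg1 t1.
have PXn i : forall k, P ('X_i ^+ k) k.
  by elim=> [|k IHk]; rewrite ?expr0 // exprS -add1n; apply: PM.
have Pm m : P 'X_[m] (mdeg m).
  rewrite mpolyXE_id mdegE; elim/big_rec2: _ => [|i g a _ IH]; first exact: P1.
  exact: PM (PXn i (m i)) IH.
rewrite {1 2}(mpolyE f) raddf_sum -sumrB big_seq; apply: msize_sum_leq => m mf.
rewrite /= -mul_mpolyC rmorphM /= mmapC -mulrBr mul_mpolyC.
rewrite (leq_trans (msizeZ_le _ _)) //; have /andP[_ /leq_trans] := Pm m; apply.
by have := msize_mdeg_lt mf; lia.
Qed.

End Degree.

(** * Reflections and polynomials in the lambdas *)

Section Reflections.
Context {R : numFieldType} {p : nat} (b : 'I_p -> R).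
Implicit Types (i j : 'I_p) (f g h : {mpoly R[p]}).

Definition reflX i j : {mpoly R[p]} :=
  if j == i then - 'X_i - (b i)%:MP else 'X_j.

Local Notation refl i := (mmap (@mpolyC p R) (reflX i)).

Definition linP i : {mpoly R[p]} := 2 * 'X_i + (b i)%:MP.

Lemma reflX_id i : refl i 'X_i = - 'X_i - (b i)%:MP.
Proof. by rewrite psubX /reflX eqxx. Qed.

Lemma reflX_neq i j : j != i -> refl i 'X_j = 'X_j.
Proof. by move=> /negPf nji; rewrite psubX /reflX nji. Qed.

Lemma refl_linP i : refl i (linP i) = - linP i.
Proof. by rewrite rmorphD rmorphM /= reflX_id mmapC rmorph_nat /linP; ring. Qed.

Lemma refl_linP_neq i j : j != i -> refl i (linP j) = linP j.
Proof. by move=> nji; rewrite rmorphD rmorphM /= reflX_neq // mmapC rmorph_nat. Qed.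

Lemma msize_linP i : msize (linP i) = 2%N.
Proof.
apply/eqP; rewrite eqn_leq; apply/andP; split.
  rewrite msizeD_leq ?(leq_trans (msizeC_leq _ _)) //.
  by rewrite -mpolyC_nat mul_mpolyC (leq_trans (msizeZ_le _ _)) // msizeX mdeg1.
have -> : 2%N = (mdeg U_(i)%MM).+1 by rewrite mdeg1.
apply: msize_mdeg_lt; rewrite mcoeff_msupp mcoeffD -mpolyC_nat mcoeffCM mcoeffXU.
by rewrite eqxx mulr1 mcoeffC mnm1_eq0 mulr0 addr0 pnatr_eq0.
Qed.

Lemma linP_neq0 i : linP i != 0.
Proof. by rewrite -msize_poly_eq0 msize_linP. Qed.

Lemma refl_prod_linP s i : uniq s -> i \in s ->
  refl i (\prod_(j <- s) linP j) = - \prod_(j <- s) linP j.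
Proof.
move=> us si; rewrite !(bigD1_seq i) //= rmorphM /= refl_linP rmorph_prod mulNr.
by congr (- (_ * _)); apply: eq_bigr => j nji; rewrite /= refl_linP_neq.
Qed.

(** An h with sigma_i h = - h satisfies
    2 h = h - sigma_i h, a multiple of x_i - sigma_i(x_i) = 2 x_i + beta_i. *)
Lemma anti_invariant_dvd s h : uniq s -> (forall i, i \in s -> refl i h = - h) ->
  exists2 q, h = (\prod_(i <- s) linP i) * q & (msize q <= msize h - size s)%N.
Proof.
elim: s h => [|i s IH] h /=; first by move=> _ _; exists h;
  rewrite ?big_nil ?mul1r ?subn0.
case/andP => nis us anti.
have [q1 Hq1] := @psub_dvd _ _ _ (fun j => 'X_j) (reflX i) i h
  (fun j nji => esym (ifN _ _ nji)).
have hi : refl i h = - h by apply: anti; rewrite inE eqxx.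
have Hh : h = linP i * (2^-1%:MP * q1).
  have : h + h = linP i * q1.
    move: Hq1; rewrite psub_id hi opprK => ->; rewrite /reflX eqxx /linP; ring.
  rewrite mulrCA => <-; have -> : h + h = 2%:MP * h by rewrite mpolyC_nat mulr_natl.
  by rewrite mulrA -mpolyCM mulVf ?pnatr_eq0 // mpolyC1 mul1r.
move: Hh; set h1 := _ * q1 => Hh.
have [j js|q Hq szq] := IH h1 us.
  apply: (mulfI (linP_neq0 i)); rewrite mulrN -Hh.
  have nij : i != j by apply: contraNneq nis => ->.
  by rewrite -(refl_linP_neq nij) -rmorphM -Hh /= anti // inE js orbT.
exists q; first by rewrite big_cons -mulrA -Hq.
apply: leq_trans szq _; rewrite subnS -!subn1 subnAC leq_sub2r // subn1.
by apply: (msize_cofactor (msize_linP i)); rewrite -Hh.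
Qed.

Lemma anti_invariant_quotient s h q : uniq s ->
  h = (\prod_(i <- s) linP i) * q -> 
  forall i, i \in s -> refl i h = - h -> refl i q = q.
Proof.
move=> us Hh i si; have D0 : \prod_(i <- s) linP i != 0.
  by rewrite prodf_seq_neq0; apply/allP => j _; rewrite linP_neq0.
rewrite Hh rmorphM /= refl_prod_linP // mulNr => /oppr_inj.
by apply: mulfI.
Qed.

(** In the centred variables y_i = x_i + beta_i / 2 the reflection sigma_i
    is the change of sign of y_i. *)
Definition oppX i j : {mpoly R[p]} := if j == i then - 'X_i else 'X_j.

Lemma mcoeff_psub_oppX i h m :
  (psub (oppX i) h)@_m = (-1) ^+ m i * h@_m.
Proof.
have Xm k : psub (oppX i) 'X_[k] = (-1) ^+ k i *: 'X_[k].
  rewrite mmapX /mmap1 [in RHS]mpolyXE_id (bigD1 i) //= [in RHS](bigD1 i) //=.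
  rewrite /oppX eqxx [(- 'X_i) ^+ _]exprNn -mulrA -mul_mpolyC rmorphXn /= mpolyCN mpolyC1.
  congr (_ * (_ * _)).
  by apply: eq_bigr => j /negPf ->.
have -> : psub (oppX i) h = \sum_(k <- msupp h) h@_k *: ((-1) ^+ k i *: 'X_[k]).
  rewrite {1}(mpolyE h) raddf_sum /=; apply: eq_bigr => k _.
  by rewrite -mul_mpolyC rmorphM /= mmapC Xm mul_mpolyC.
rewrite [in RHS](mpolyE h) !(raddf_sum (mcoeff m)) /= mulr_sumr.
apply: eq_bigr => k _; rewrite !mcoeffZ mcoeffX.
by case: eqP => [->|]; rewrite ?mulr0 ?mulr1 // mulrC.
Qed.

Lemma psub_oppX_even i h : psub (oppX i) h = h ->
  forall m, m \in msupp h -> ~~ odd (m i).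
Proof.
move=> hi m; rewrite mcoeff_msupp => m0; apply/negP => om.
move/mpolyP: hi => /(_ m); rewrite mcoeff_psub_oppX -signr_odd om expr1 mulN1r.
move/eqP; rewrite -subr_eq0 -opprD oppr_eq0 -mulr2n mulrn_eq0 /=.
by rewrite (negPf m0).
Qed.

(** The inverse of the centring x_i |-> x_i - beta_i / 2. *)
Definition halfX i : {mpoly R[p]} := 'X_i + (b i / 2)%:MP.

Lemma invariant_even f : (forall i, refl i f = f) ->
  exists2 h : {mpoly R[p]}, f = psub halfX h /\ (msize h <= msize f)%N
    & forall m i, m \in msupp h -> ~~ odd (m i).
Proof.
move=> inv; pose Y i : {mpoly R[p]} := 'X_i - (b i / 2)%:MP.
exists (psub Y f).
  split.
    rewrite psub_comp -[LHS]psub_id; apply: psub_ext => i.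
    by rewrite rmorphB /= psubX mmapC addrK.
  have Y1 i : (msize (Y i) <= 2)%N.
    by rewrite msizeD_leq ?msizeN ?msizeX ?mdeg1 // (leq_trans (msizeC_leq _ _)).
  have [->|f0] := eqVneq f 0; first by rewrite rmorph0 msize0.
  apply: leq_trans (msize_psub f Y1) _; rewrite mul1n prednK // lt0n.
  by rewrite msize_poly_eq0.
move=> m i; apply: psub_oppX_even.
rewrite -[in RHS](inv i) !psub_comp; apply: psub_ext => j.
rewrite rmorphB /= psubX mmapC /oppX /reflX; case: eqP => [->|_]; last by rewrite psubX.
rewrite rmorphB rmorphN /= psubX mmapC /Y opprB.
by rewrite /= {3}(splitr (b i)) mpolyCD; ring.
Qed.

End Reflections.

Local Notation refl b i := (mmap (@mpolyC _ _) (reflX b i)).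

Section LambdaRing.
Context {R : realType} {p : nat} (beta : 'I_p.+2 -> R).

Definition pbeta (i : 'I_p) : R := bpar beta i.+1.

Lemma P_lamE d f : P_lam beta d f <->
  exists2 q : {mpoly R[p]}, (msize q <= d.+1)%N & f = psub (lam beta) q.
Proof.
by split=> -[q qd ->]; exists q => //; apply: psub_ext => i; rewrite tnth_mktuple.
Qed.

Lemma P_lam_refl d f i : P_lam beta d f -> refl pbeta i f = f.
Proof.
case/P_lamE => q _ ->; rewrite psub_comp; apply: psub_ext => j.
rewrite /lam rmorphM rmorphD /= psubX mmapC /reflX; case: eqP => [->|//].
by rewrite /pbeta; ring.
Qed.

Lemma msize_lam i : (msize (lam beta i) <= 3)%N.
Proof.
apply: (@msizeM_leq _ _ _ _ 1 1); first by rewrite msizeX mdeg1.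
by rewrite msizeD_leq ?msizeX ?mdeg1 // (leq_trans (msizeC_leq _ _)).
Qed.

Lemma P_lam_msize d f : P_lam beta d f -> (msize f <= (2 * d).+1)%N.
Proof.
case/P_lamE => q qd ->; apply: leq_trans (msize_psub _ msize_lam) _.
by rewrite ltnS leq_pmul2l // -subn1 leq_subLR.
Qed.

(** In the centred variables an invariant polynomial has only
    even exponents, and y_i^2 = lambda_i + beta_i^2 / 4. As the degree in x is
    twice the degree in lambda, one extra degree in x is harmless. *)
Lemma invariant_P_lam d f : (msize f <= (2 * d).+2)%N ->
  (forall i, refl pbeta i f = f) -> P_lam beta d f.
Proof.
move=> szf inv; have [h [Hf szh] even_h] := invariant_even inv.
apply/P_lamE; pose u i : {mpoly R[p]} := 'X_i + (pbeta i ^+ 2 / 4)%:MP.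
exists (\sum_(m <- msupp h) h@_m *: \prod_i u i ^+ (m i)./2).
  rewrite big_seq; apply: msize_sum_leq => m mh.
  rewrite (leq_trans (msizeZ_le _ _)) //.
  have u1 i : (msize (u i) <= 2)%N.
    by rewrite msizeD_leq ?msizeX ?mdeg1 // (leq_trans (msizeC_leq _ _)).
  have := @msize_prod_leq _ _ _ (index_enum 'I_p) predT (fun i => u i ^+ (m i)./2)
    (fun i => (m i)./2 * 1)%N (fun i _ => msize_exp_leq (m i)./2 (u1 i)).
  move/leq_trans; apply; rewrite ltnS.
  have le2 : (2 * \sum_(i < p) ((m i)./2 * 1) <= mdeg m)%N.
    rewrite mdegE big_distrr /=; apply: leq_sum => i _.
    by rewrite muln1 mul2n -[X in (_ <= X)%N]odd_double_half leq_addl.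
  have := leq_trans (msize_mdeg_lt mh) (leq_trans szh szf).
  by move: le2; generalize (mdeg m) => k; set S := bigop _ _ _; lia.
rewrite Hf {1}(mpolyE h) !raddf_sum /=; rewrite big_seq [RHS]big_seq.
apply: eq_bigr => m mh; rewrite -!mul_mpolyC !rmorphM /= !mmapC mmapX.
congr (_ * _); rewrite rmorph_prod; apply: eq_bigr => i _ /=.
rewrite rmorphXn /= rmorphD /= psubX mmapC /=.
rewrite -[in LHS](odd_double_half (m i)) (negPf (even_h m i mh)) add0n -mul2n exprM.
congr (_ ^+ _); rewrite /halfX /lam -/(pbeta i).
have -> : (pbeta i ^+ 2 / 4)%:MP = (pbeta i / 2)%:MP ^+ 2 :> {mpoly R[p]}.
  by rewrite -rmorphXn /=; congr (_%:MP); field.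
have -> : (pbeta i)%:MP = (pbeta i / 2)%:MP + (pbeta i / 2)%:MP :> {mpoly R[p]}.
  by rewrite -mpolyCD -splitr.
ring.
Qed.

End LambdaRing.

(** * The operator as a quotient of polynomials *)

Definition opp3 (c : 'I_3) : 'I_3 := rev_ord c.

Lemma opp3_neg : opp3 neg3 = pos3. Proof. exact: val_inj. Qed.
Lemma opp3_nul : opp3 nul3 = nul3. Proof. exact: val_inj. Qed.
Lemma opp3_pos : opp3 pos3 = neg3. Proof. exact: val_inj. Qed.
Definition opp3E := (opp3_neg, opp3_nul, opp3_pos).

Lemma opp3K : involutive opp3. Proof. exact: rev_ordK. Qed.

Lemma opp3_eq0 c : (opp3 c == nul3) = (c == nul3).
Proof. by elim/sign3P: c; rewrite opp3E. Qed.

Section Sgn3.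
Context {A : comNzRingType}.
Lemma sgn3_neg : sgn3 neg3 = -1 :> A. Proof. by rewrite /sgn3 sub0r. Qed.
Lemma sgn3_nul : sgn3 nul3 = 0 :> A. Proof. by rewrite /sgn3 subrr. Qed.
Lemma sgn3_pos : sgn3 pos3 = 1 :> A. Proof. by rewrite /sgn3 /=; ring. Qed.
Lemma sgn3_opp c : sgn3 (opp3 c) = - sgn3 c :> A.
Proof. by elim/sign3P: c;
  rewrite opp3E ?sgn3_neg ?sgn3_nul ?sgn3_pos ?opprK ?oppr0. Qed.
Lemma sgn3_sqr c : c != nul3 -> sgn3 c * sgn3 c = 1 :> A.
Proof. by elim/sign3P: c => // _; rewrite ?sgn3_neg ?sgn3_pos ?mulrNN mulr1. Qed.
End Sgn3.

Lemma rmorph_sgn3 (A B : comNzRingType) (phi : {rmorphism A -> B}) c :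
  phi (sgn3 c) = sgn3 c.
Proof. by rewrite /sgn3 rmorphB rmorph1 rmorph_nat. Qed.

Lemma rmorph_bond (A B : comNzRingType) (phi : {rmorphism A -> B}) a c y b z b' :
  phi (bond a c y b z b') = bond a c (phi y) (phi b) (phi z) (phi b').
Proof.
have phiM c0 x w : phi (mirror c0 w x) = mirror c0 (phi w) (phi x).
  by rewrite /mirror; case: ifP; rewrite // rmorphB rmorphN.
rewrite /bond; case: ifP => _; case: ifP => _;
  by do 3! rewrite ?rmorphD ?rmorphM ?rmorphN /= ?rmorph1 ?rmorph_nat ?phiM.
Qed.

Lemma bond_opp_l (A : comNzRingType) a c (y b z b' : A) : a != nul3 ->
  bond a c (- y - b) b z b' = bond (opp3 a) c y b z b'.
Proof.
by elim/sign3P: a => // _; rewrite opp3E /bond /mirror /=;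
  case: ifP => // _; ring.
Qed.

Lemma bond_opp_r (A : comNzRingType) a c (y b z b' : A) : c != nul3 ->
  bond a c y b (- z - b') b' = bond a (opp3 c) y b z b'.
Proof.
by elim/sign3P: c => // _; rewrite opp3E /bond /mirror /=;
  case: ifP => // _; ring.
Qed.

Section Operator.
Context {R : numFieldType} {p : nat} (b : 'I_p -> R) (b0 bN : R) (N : nat).
Implicit Types (i j : 'I_p) (c : 'I_3) (f g h : {mpoly R[p]}).
Implicit Types (nu : {ffun 'I_p -> 'I_3}) (s : seq 'I_p).

Definition translX i c j : {mpoly R[p]} :=
  if j == i then 'X_i + sgn3 c else 'X_j.

Definition transl i c : {additive {mpoly R[p]} -> {mpoly R[p]}} :=
  mmap (@mpolyC p R) (translX i c).

Definition flip i nu := update i (opp3 (nu i)) nu.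

Lemma flipE i nu j : flip i nu j = if j == i then opp3 (nu j) else nu j.
Proof. by rewrite ffunE; case: eqP => [->|]. Qed.

Lemma flipK i : involutive (flip i).
Proof. by move=> nu; apply/ffunP => j; rewrite !flipE; case: eqP => // _;
  rewrite opp3K. Qed.

Lemma transl_nul i h : transl i nul3 h = h.
Proof.
rewrite -[RHS]psub_id; apply: psub_ext => j; rewrite /translX sgn3_nul addr0.
by case: eqP => [->|].
Qed.

Lemma translM i c g h : transl i c (g * h) = transl i c g * transl i c h.
Proof. exact: rmorphM. Qed.

Lemma refl_transl i j c h :
  refl b i (transl j c h)
  = transl j (if j == i then opp3 c else c) (refl b i h).
Proof.
rewrite /transl /= !psub_comp; apply: psub_ext => k; rewrite /translX.
have [->|nkj] := eqVneq k j.
  rewrite rmorphD /= psubX rmorph_sgn3 /reflX; have [->|nji] := eqVneq j i.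
    by rewrite rmorphB rmorphN /= psubX mmapC /= eqxx sgn3_opp; ring.
  by rewrite psubX eqxx.
rewrite psubX /reflX; have [ki|nki] := eqVneq k i; last by rewrite psubX (negPf nkj).
rewrite -ki eq_sym (negPf nkj) rmorphB rmorphN /= psubX mmapC.
by rewrite (negPf nkj).
Qed.

Local Notation diff := (hop_op transl).

Lemma refl_diff i j c h :
  refl b i (diff j c h) = diff j (if j == i then opp3 c else c) (refl b i h).
Proof.
rewrite /hop_op; have -> : ((if j == i then opp3 c else c) == nul3) = (c == nul3).
  by case: ifP; rewrite ?opp3_eq0.
by case: ifP => // _; rewrite rmorphB /= refl_transl.
Qed.

(** Conjugating by sigma_i exchanges the forward and backward
    differences in the direction i, hence flips the sign of nu_i. *)
Lemma refl_chain_op i nu s h :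
  refl b i (chain_op diff nu s h) = chain_op diff (flip i nu) s (refl b i h).
Proof.
by elim: s h => //= j s IH h; rewrite IH refl_diff flipE.
Qed.

(** The linear form that divides the difference of sign c in the
    direction i of an invariant polynomial. It is one of the two factors of the
    denominator of A_nu at the site i. *)
Definition hopfac i c : {mpoly R[p]} :=
  if c == nul3 then 1 else sgn3 c * linP b i + 1.

(** The quotient of 2 x_i + beta_i by the other factor of the
    denominator of A_nu at the site i, which is sgn3 c * (2 x_i + beta_i) for a
    nonzero sign c and 1 for the sign 0. *)
Definition sgnfac i c : {mpoly R[p]} := if c == nul3 then linP b i else sgn3 c.

Lemma refl_hopfac i j c :
  refl b i (hopfac j c) = hopfac j (if j == i then opp3 c else c).
Proof.
rewrite /hopfac; have -> : ((if j == i then opp3 c else c) == nul3) = (c == nul3).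
  by case: ifP; rewrite ?opp3_eq0.
case: ifP => _; first by rewrite rmorph1.
rewrite rmorphD rmorphM /= rmorph1 rmorph_sgn3; have [->|nji] := eqVneq j i.
  by rewrite refl_linP sgn3_opp mulrN mulNr.
by rewrite refl_linP_neq.
Qed.

Lemma refl_sgnfac i j c :
  refl b i (sgnfac j c) = (-1) ^+ (j == i) * sgnfac j (if j == i then opp3 c else c).
Proof.
rewrite /sgnfac; have -> : ((if j == i then opp3 c else c) == nul3) = (c == nul3).
  by case: ifP; rewrite ?opp3_eq0.
case: ifP => _; have [eji|nji] := eqVneq j i.
- by rewrite eji refl_linP expr1 mulN1r.
- by rewrite refl_linP_neq // expr0 mul1r.
- by rewrite rmorph_sgn3 sgn3_opp expr1 mulN1r opprK.
- by rewrite rmorph_sgn3 expr0 mul1r.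
Qed.

Lemma msize_sgn3 c : (msize (sgn3 c : {mpoly R[p]}) <= 1)%N.
Proof. by rewrite /sgn3 -mpolyC_nat -mpolyC1 -mpolyCB msizeC_leq. Qed.

Lemma msize_hopfac i c : c != nul3 -> msize (hopfac i c) = 2%N.
Proof.
move=> c0; rewrite /hopfac (negPf c0).
apply/eqP; rewrite eqn_leq; apply/andP; split.
  rewrite msizeD_leq ?msize1 //.
  by apply: (@msizeM_leq _ _ _ _ 0 1); rewrite ?msize_sgn3 ?msize_linP.
have : msize (sgn3 c * (sgn3 c * linP b i)) = 2%N.
  by rewrite mulrA sgn3_sqr // mul1r msize_linP.
rewrite leqNgt ltnS => e; apply/negP => le1.
have : (msize (sgn3 c * linP b i : {mpoly R[p]}) <= 1)%N.
  by rewrite -[_ * _](addrK 1) msizeD_leq ?msizeN ?msize1.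
by move/(msizeM_leq (msize_sgn3 c)); rewrite e.
Qed.

Lemma hopfac_neq0 i c : hopfac i c != 0.
Proof.
have [->|c0] := eqVneq c nul3; first by rewrite /hopfac eqxx oner_neq0.
by rewrite -msize_poly_eq0 msize_hopfac.
Qed.

(** As h is also its own image under sigma_i, the difference compares
    two substitutions, the translation and sigma_i, that differ at x_i by the
    factor hopfac up to sign. The difference lowers the degree once and the
    division lowers it again. *)
Lemma diff_dvd i c h : refl b i h = h ->
  exists2 g, diff i c h = hopfac i c * g
    & (msize g <= msize h - (c != nul3).*2)%N.
Proof.
move=> inv; have [->|c0] := eqVneq c nul3.
  by exists h; rewrite ?subn0 // /hop_op /hopfac eqxx mul1r.
have tu j : j != i -> translX i c j = reflX b i j.
  by move=> /negPf nji; rewrite /translX /reflX nji.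
have [q Hq] := @psub_dvd _ _ _ (translX i c) (reflX b i) i h tu.
have Hg : diff i c h = hopfac i c * (sgn3 c * q).
  rewrite /hop_op /hopfac (negPf c0) -[X in _ - X]inv /= Hq.
  rewrite mulrA; have -> : (sgn3 c * linP b i + 1) * sgn3 c = linP b i + sgn3 c.
    by rewrite mulrDl mulrAC sgn3_sqr // !mul1r.
  by congr (_ * _); rewrite /translX /reflX eqxx /linP; ring.
exists (sgn3 c * q) => //.
rewrite subn2; apply: (msize_cofactor (msize_hopfac i c0)); rewrite -Hg.
rewrite /hop_op (negPf c0); apply: msize_psub_sub => j.
by rewrite /translX; case: eqP => [->|_];
  rewrite ?subrr ?msize0 // addrAC subrr add0r msize_sgn3.
Qed.

Lemma transl_hopfac i j c d : i != j -> transl i c (hopfac j d) = hopfac j d.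
Proof.
move=> nij; rewrite /transl /hopfac /=; case: ifP => _; first by rewrite rmorph1.
rewrite rmorphD rmorphM /= rmorph1 rmorph_sgn3; congr (_ * _ + _).
by rewrite rmorphD rmorphM /= psubX mmapC rmorph_nat /translX eq_sym (negPf nij).
Qed.

(** A linear form in x_i is a constant for the differences in
    the other directions. *)
Lemma chain_op_hopfac nu s i c h : i \notin s ->
  chain_op diff nu s (hopfac i c * h) = hopfac i c * chain_op diff nu s h.
Proof.
elim: s h => //= j s IH h; rewrite inE negb_or => /andP[nij nis].
rewrite -IH //; congr chain_op; rewrite /hop_op; case: ifP => // _.
by rewrite mulrBr translM transl_hopfac // eq_sym.
Qed.

Lemma chain_op_dvd nu s h : uniq s -> (forall i, i \in s -> refl b i h = h) ->
  exists2 g, chain_op diff nu s h = (\prod_(i <- s) hopfac i (nu i)) * g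
    & (msize g <= msize h - (count (fun i => nu i != nul3) s).*2)%N.
Proof.
elim: s h => [|i s IH] h /=.
  by move=> _ _; exists h; rewrite ?subn0 // big_nil mul1r.
case/andP => nis us inv.
have [|g1 Hg1 sz1] := @diff_dvd i (nu i) h; first by apply: inv; rewrite inE eqxx.
have [j js|g Hg sz] := IH g1 us.
  have nji : i != j by apply: contraNneq nis => ->.
  apply: (mulfI (hopfac_neq0 i (nu i))); rewrite -Hg1.
  have := refl_hopfac j i (nu i); rewrite (negPf nji) => <-.
  rewrite -rmorphM /= -Hg1 refl_diff (negPf nji) inv // inE js orbT //.
exists g; first by rewrite Hg1 chain_op_hopfac // Hg big_cons mulrA.
by apply: leq_trans sz _; rewrite doubleD subnDA leq_sub2r.
Qed.

Local Notation psite := ('I_3 * {mpoly R[p]} * R)%type.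

Definition num_wt i c (t : psite) : {mpoly R[p]} :=
  if c == nul3 then 1 else bond t.1.1 c t.1.2 t.2%:MP 'X_i (b i)%:MP.
Definition num_next i c (t : psite) : psite :=
  if c == nul3 then t else (c, 'X_i, b i).
Definition num_last (t : psite) : {mpoly R[p]} :=
  bond t.1.1 nul3 t.1.2 t.2%:MP N%:R bN%:MP.
Local Notation num_chain := (chain_wt num_wt num_next num_last).
(** Twice the numerator of A_nu, as a chain of bonds between the sites
    with nonzero sign. *)
Definition numer nu := num_chain nu (enum 'I_p) (nul3, 0, b0).

Lemma refl_bond i a c y e z e' :
  refl b i (bond a c y e%:MP z e'%:MP)
  = bond a c (refl b i y) e%:MP (refl b i z) e'%:MP.
Proof. by rewrite (rmorph_bond (mmap (@mpolyC p R) (reflX b i))) /= !mmapC. Qed.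

Lemma refl_bondX i j a c y e : c != nul3 ->
  refl b i (bond a c y e%:MP 'X_j (b j)%:MP)
  = bond a (if j == i then opp3 c else c) (refl b i y) e%:MP 'X_j (b j)%:MP.
Proof.
move=> c0; rewrite refl_bond; have [->|nji] := eqVneq j i.
  by rewrite reflX_id bond_opp_r.
by rewrite reflX_neq.
Qed.

Lemma refl_num_chain i nu s (t u : psite) :
  t.2 = u.2 ->
  (forall d z b', bond t.1.1 d (refl b i t.1.2) t.2%:MP z b'
    = bond u.1.1 d u.1.2 u.2%:MP z b' :> {mpoly R[p]}) ->
  refl b i (num_chain nu s t) = num_chain (flip i nu) s u.
Proof.
elim: s t u => [|j s IH] t u e22 tu /=.
  by rewrite /num_last -mpolyC_nat refl_bond tu mmapC.
rewrite /num_wt /num_next flipE.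
have -> : ((if j == i then opp3 (nu j) else nu j) == nul3) = (nu j == nul3).
  by case: (j == i); rewrite ?opp3_eq0.
have [c0|c0] := eqVneq (nu j) nul3; first by rewrite !mul1r; apply: IH.
rewrite [LHS]rmorphM; congr (_ * _).
  by rewrite [LHS]refl_bondX // tu.
apply: IH; first exact: erefl.
move=> d z b'; cbn [fst snd].
move: c0; have [->|nji] := eqVneq j i => c0.
  by rewrite reflX_id bond_opp_l.
by rewrite reflX_neq.
Qed.

Lemma refl_numer i nu : refl b i (numer nu) = numer (flip i nu).
Proof.
apply: refl_num_chain; first exact: erefl.
by move=> d z b'; cbn [fst snd]; rewrite mmap0.
Qed.

Lemma msize_bond a c (y z : {mpoly R[p]}) b1 b2 :
  (msize y <= 2)%N -> (msize z <= 2)%N ->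
  (msize (bond a c y b1%:MP z b2%:MP) <= 3)%N.
Proof.
move=> y2 z2.
have C k (e : R) : (msize (e%:MP : {mpoly R[p]}) <= k.+1)%N.
  exact: leq_trans (msizeC_leq _ _) _.
have C1 k : (msize (1 : {mpoly R[p]}) <= k.+1)%N by rewrite -mpolyC1.
have C2 k : (msize (2 : {mpoly R[p]}) <= k.+1)%N by rewrite -mpolyC_nat.
have My (s : 'I_3) e (w : {mpoly R[p]}) : (msize w <= 2)%N ->
  (msize (mirror s e%:MP w) <= 2)%N.
  by move=> w2; rewrite /mirror; case: ifP => // _; rewrite msizeD_leq ?msizeN.
have M11 := @msizeM_leq R p _ _ 1 1.
have M02 := @msizeM_leq R p _ _ 0 2.
rewrite /bond; case: ifP => _; case: ifP => _.
- apply: msizeD_leq; last by apply: M11; rewrite msizeD_leq ?msizeN.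
  apply: M02 => //; apply: msizeD_leq; apply: M11; rewrite ?msizeD_leq //.
- by apply: M11; rewrite !(msizeD_leq, msizeN) ?My.
- by apply: M02 => //; apply: M11; rewrite !(msizeD_leq, msizeN) ?My.
- by apply: M11; rewrite !(msizeD_leq, msizeN) ?My.
Qed.

Lemma msize_num_chain nu s (t : psite) : (msize t.1.2 <= 2)%N ->
  (msize (num_chain nu s t) <= (count (fun i => nu i != nul3) s).*2.+3)%N.
Proof.
elim: s t => [|i s IH] t t2 /=.
  by rewrite /num_last -mpolyC_nat msize_bond // (leq_trans (msizeC_leq _ _)).
rewrite /num_wt /num_next; case: ifP => _ /=; first by rewrite mul1r IH.
rewrite doubleD add2n -[_.+4.+1]/(2 + (_.*2).+2).+1.
by apply: msizeM_leq; rewrite ?msize_bond ?IH //= msizeX mdeg1.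
Qed.

Definition nonzero nu := [exists i, nu i != nul3].

(** The numerator of 2 L_p f over prod_i (2 x_i + beta_i)
    is anti-invariant: sigma_i permutes its summands by flipping nu_i, up to
    the sign carried by sgnfac. If nu has n nonzero signs, the numerator of
    A_nu has degree 2 n + 2, the divided difference of f degree at most
    2 d - 2 n and the remaining factors degree p - n; since n > 0 the sum is at
    most 2 d + 1 + p. *)
Lemma operator_polynomial d f :
  (forall i, refl b i f = f) -> (msize f <= (2 * d).+1)%N ->
  exists (g : {ffun 'I_p -> 'I_3} -> {mpoly R[p]}) Q,
  [/\ forall nu, chain_op diff nu (enum 'I_p) f
                 = (\prod_(i <- enum 'I_p) hopfac i (nu i)) * g nu,
      \sum_(nu | nonzero nu) numer nu * g nu * \prod_(i <- enum 'I_p) sgnfac i (nu i)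
      = (\prod_(i <- enum 'I_p) linP b i) * Q,
      forall i, refl b i Q = Q
    & (msize Q <= (2 * d).+2)%N].
Proof.
move=> inv szf; have uE := enum_uniq 'I_p.
have /choice[g Hg] nu : exists g,
    chain_op diff nu (enum 'I_p) f = (\prod_(i <- enum 'I_p) hopfac i (nu i)) * g
    /\ (msize g <= msize f - (count (fun i => nu i != nul3) (enum 'I_p)).*2)%N.
  by have [|g] := @chain_op_dvd nu (enum 'I_p) f uE; [move=> i _; apply: inv|exists g].
have refl_g i nu : refl b i (g nu) = g (flip i nu).
  have [/(congr1 (fun h => refl b i h)) e _] := Hg nu.
  have [e' _] := Hg (flip i nu).
  have nz : \prod_(j <- enum 'I_p) hopfac j (flip i nu j) != 0.
    by rewrite prodf_seq_neq0; apply/allP => j _; rewrite hopfac_neq0.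
  apply: (mulfI nz); rewrite -e' -[in RHS](inv i) -refl_chain_op e rmorphM rmorph_prod /=.
  by congr (_ * _); apply: eq_bigr => j _; rewrite refl_hopfac flipE.
pose H nu := numer nu * g nu * \prod_(i <- enum 'I_p) sgnfac i (nu i).
have refl_H i nu : refl b i (H nu) = - H (flip i nu).
  rewrite !rmorphM rmorph_prod /= refl_numer refl_g -mulrN; congr (_ * _).
  rewrite (eq_bigr (fun j => (-1) ^+ (j == i) * sgnfac j (flip i nu j))); last first.
    by move=> j _; rewrite refl_sgnfac flipE.
  rewrite big_split /= (bigD1_seq i) ?mem_enum ?enum_uniq //= eqxx expr1.
  by rewrite big1 ?mulr1 ?mulN1r // => j /negPf ->.
have anti i : refl b i (\sum_(nu | nonzero nu) H nu) = - \sum_(nu | nonzero nu) H nu.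
  rewrite rmorph_sum -sumrN (reindex_inj (can_inj (flipK i))) /=.
  apply: eq_big => [nu|nu _]; last by rewrite refl_H flipK.
  by apply: eq_existsb => j; rewrite flipE; case: ifP; rewrite ?opp3_eq0.
have [|Q HQ szQ] := anti_invariant_dvd uE (h := \sum_(nu | nonzero nu) H nu) (b := b).
  by move=> i _; apply: anti.
exists g, Q; split => //.
- by move=> nu; case: (Hg nu).
- move=> i; apply: (anti_invariant_quotient uE HQ); rewrite ?mem_enum //.
apply: leq_trans szQ _; rewrite leq_subLR size_enum_ord.
apply: msize_sum_leq => nu /existsP[k nuk].
rewrite /H; have [->|g0] := eqVneq (g nu) 0; first by rewrite mulr0 mul0r msize0.
have [_ szg] := Hg nu; move: szg; set n := count _ _ => szg.
have n0 : (0 < n)%N by rewrite -has_count; apply/hasP; exists k; rewrite ?mem_enum.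
have szs : (msize (\prod_(i <- enum 'I_p) sgnfac i (nu i)) <= (p - n).+1)%N.
  have -> : (p - n = \sum_(i <- enum 'I_p) (nu i == nul3))%N.
    rewrite -{1}(size_enum_ord p) -(count_predC (fun i => nu i != nul3)) addKn.
    rewrite -sum1_count big_mkcond; apply: eq_bigr => i _ /=.
    by rewrite negbK; case: eqP.
  apply: msize_prod_leq => i _; rewrite /sgnfac; case: ifP => _.
    by rewrite msize_linP.
  exact: msize_sgn3.
have np : (n <= p)%N by rewrite -(size_enum_ord p) count_size.
have g1 : (0 < msize (g nu))%N by rewrite lt0n msize_poly_eq0.
have szg' : (msize (g nu) <= (2 * d - n.*2).+1)%N.
  by move: szg szf g1; move: (msize _) (msize _) => u v; lia.
have sz0 : (msize (numer nu) <= n.*2.+3)%N.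
  by apply: msize_num_chain; rewrite msize0.
apply: leq_trans (msizeM_leq (msizeM_leq sz0 szg') szs) _.
by move: szg szf g1 n0 np; move: (msize _) (msize _) => u v; lia.
Qed.

End Operator.

(** * From rational functions to polynomials *)

(** Substitution into a rational function is defined on a chosen
    representative, whose only known property is this equation. *)
Lemma frac_repr (D : idomainType) (x : {fraction D}) :
  x = FracField.tofrac (\n_(repr x)) / FracField.tofrac (\d_(repr x)).
Proof.
have d0 : FracField.tofrac (\d_(repr x)) != 0 by rewrite tofrac_eq0 denom_ratioP.
apply: (mulIf d0); rewrite mulfVK // -{1}(reprK x); set y := repr x.
unlock FracField.tofrac; rewrite -[LHS]FracField.pi_mul.
apply/eqmodP; rewrite /= FracField.equivfE /FracField.mulf.
rewrite !numden_Ratio ?mulf_neq0 ?oner_neq0 ?denom_ratioP //.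
by rewrite !mulr1 mulrC.
Qed.

Lemma foldr_comm (T S : Type) (F : T -> S -> S) (u : S -> S) s x :
  (forall i y, u (F i y) = F i (u y)) -> u (foldr F x s) = foldr F (u x) s.
Proof. by move=> uF; elim: s => //= i s <-; rewrite uF. Qed.

Lemma subr_swap (V : zmodType) (t u v w : V) : t - u - (v - w) = t - v - (u - w).
Proof. by rewrite !opprB addrACA [RHS]addrACA [- u + _]addrC [- v + _]addrC addrAC. Qed.

(** For commuting families, all backward differences followed by
    all forward ones amount to treating the sites one by one. *)
Lemma foldr_foldr (T S : Type) (F G : T -> S -> S) s x :
  (forall i j y, F i (F j y) = F j (F i y)) ->
  (forall i j y, F i (G j y) = G j (F i y)) ->
  (forall i j y, G i (G j y) = G j (G i y)) ->
  foldr F (foldr G x s) s = foldl (fun y i => F i (G i y)) x s.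
Proof.
move=> FF FG GG; elim: s x => //= i s IH x; rewrite -IH.
rewrite (@foldr_comm _ _ G (G i)) // -(@foldr_comm _ _ G (F i)) //.
by rewrite (@foldr_comm _ _ F (F i)) // (@foldr_comm _ _ G (F i)).
Qed.

Section PolyF.
Context {R : realType} {p : nat}.
Implicit Types (f g h : {mpoly R[p]}).

Lemma polyFM f g : polyF (f * g) = polyF f * polyF g.
Proof. exact: tofracM. Qed.
Lemma polyFD f g : polyF (f + g) = polyF f + polyF g.
Proof. exact: tofracD. Qed.
Lemma polyFN f : polyF (- f) = - polyF f.
Proof. exact: tofracN. Qed.
Lemma polyFB f g : polyF (f - g) = polyF f - polyF g.
Proof. exact: tofracB. Qed.
Lemma polyF1 : polyF (1 : {mpoly R[p]}) = 1.
Proof. exact: tofrac1. Qed.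
Lemma polyF_nat n : polyF (n%:R : {mpoly R[p]}) = n%:R.
Proof. exact: (rmorph_nat (@FracField.tofrac {mpoly R[p]})). Qed.
Lemma polyF_sum (I : Type) (r : seq I) (P : pred I) (F : I -> {mpoly R[p]}) :
  polyF (\sum_(i <- r | P i) F i) = \sum_(i <- r | P i) polyF (F i).
Proof. exact: (raddf_sum (@FracField.tofrac {mpoly R[p]})). Qed.
Lemma polyF_prod (I : Type) (r : seq I) (P : pred I) (F : I -> {mpoly R[p]}) :
  polyF (\prod_(i <- r | P i) F i) = \prod_(i <- r | P i) polyF (F i).
Proof. exact: (rmorph_prod (@FracField.tofrac {mpoly R[p]})). Qed.
Lemma polyF_eq0 f : (polyF f == 0) = (f == 0).
Proof. exact: tofrac_eq0. Qed.
Lemma polyF_inj : injective (@polyF R p).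
Proof. by move=> f g /eqP; rewrite tofrac_eq => /eqP. Qed.

Lemma mmap_cstF (t : 'I_p -> {mpoly R[p]}) h :
  mmap cstF (fun i => polyF (t i)) h = polyF (psub t h).
Proof. exact/esym/(psub_rmorph (@FracField.tofrac {mpoly R[p]})). Qed.

(** An invertible substitution of polynomials extends to fractions
    independently of the representative. *)
Lemma substF_frac (t u : 'I_p -> {mpoly R[p]}) f g :
  (forall h, psub u (psub t h) = h) -> g != 0 ->
  substF (fun i => polyF (t i)) (polyF f / polyF g)
  = polyF (psub t f) / polyF (psub t g).
Proof.
move=> tK g0; have tnz h : h != 0 -> polyF (psub t h) != 0.
  move=> h0; rewrite polyF_eq0; apply: contra_neq h0 => th0.
  by rewrite -[h]tK th0 raddf0.
set r := polyF f / polyF g; have d0 : \d_(repr r) != 0 by apply: denom_ratioP.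
rewrite /substF !mmap_cstF; apply/eqP; rewrite eqr_div ?tnz //.
rewrite -!polyFM -!(rmorphM (mmap (@mpolyC p R) t)); apply/eqP;
  congr (polyF (psub t _)).
apply: polyF_inj; rewrite !polyFM; apply/eqP; rewrite -eqr_div ?polyF_eq0 //.
by rewrite eq_sym; apply/eqP; rewrite -/r [in LHS](frac_repr r).
Qed.

Lemma substF_polyF (t u : 'I_p -> {mpoly R[p]}) f :
  (forall h, psub u (psub t h) = h) ->
  substF (fun i => polyF (t i)) (polyF f) = polyF (psub t f).
Proof.
move=> tK; rewrite -[polyF f]divr1 -polyF1 (substF_frac f tK) ?oner_neq0 //.
by rewrite rmorph1 polyF1 divr1.
Qed.

End PolyF.

Section Bridge.
Context {R : realType} {p : nat} (beta : 'I_p.+2 -> R) (N : nat).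
Implicit Types (i j : 'I_p) (f g h : {mpoly R[p]}) (nu : {ffun 'I_p -> 'I_3}).
Local Notation b := (pbeta beta).
Local Notation diff := (hop_op (@transl R p)).

Lemma reflK i h : refl b i (refl b i h) = h.
Proof.
rewrite psub_comp -[RHS]psub_id; apply: psub_ext => j.
rewrite {2}/reflX; have [->|nji] := eqVneq j i; last by rewrite reflX_neq.
by rewrite rmorphB rmorphN /= reflX_id mmapC /=; ring.
Qed.

Lemma translXE i c k :
  translX i c k = 'X_k + (if k == i then sgn3 c else 0) :> {mpoly R[p]}.
Proof. by rewrite /translX; case: eqP => [->|]; rewrite ?addr0. Qed.

Lemma psub_translX (u : 'I_p -> {mpoly R[p]}) i c k :
  psub u (translX i c k) = u k + (if k == i then sgn3 c else 0).
Proof.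
rewrite translXE mmapD psubX; congr (_ + _).
by case: ifP => _; rewrite ?mmap0 // (rmorph_sgn3 (mmap (@mpolyC p R) u)).
Qed.

Lemma transl_comm i j c d h :
  transl i c (transl j d h) = transl j d (transl i c h).
Proof.
rewrite /transl /= !psub_comp; apply: psub_ext => k.
by rewrite !psub_translX !translXE addrAC.
Qed.

Lemma translK i c h : transl i (opp3 c) (transl i c h) = h.
Proof.
rewrite /transl /= psub_comp -[RHS]psub_id; apply: psub_ext => k.
rewrite psub_translX translXE sgn3_opp; case: ifP => _; last by rewrite !addr0.
by rewrite subrK.
Qed.

Lemma diff_comm i j c d h : diff i c (diff j d h) = diff j d (diff i c h).
Proof.
rewrite /hop_op; case: (c == nul3); case: (d == nul3);
  [exact: erefl|exact: erefl|exact: erefl|].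
rewrite (raddfB (transl i c)) (raddfB (transl j d)) transl_comm.
exact: subr_swap.
Qed.

Lemma reflF_frac i f g : g != 0 ->
  reflF beta i (polyF f / polyF g) = polyF (refl b i f) / polyF (refl b i g).
Proof.
move=> g0; rewrite -(substF_frac f (reflK i)) //; congr substF; apply/funext => j.
rewrite /reflX; case: eqP => // _.
by rewrite /XF /cstF -polyFN -polyFB.
Qed.

Lemma fdiff_polyF i h : fdiff i (polyF h) = polyF (diff i pos3 h).
Proof.
rewrite /fdiff /hop_op polyFB; congr (_ - _).
rewrite -[RHS](@substF_polyF _ _ _ (translX i (opp3 pos3))); last exact: translK.
congr substF; apply/funext => j; rewrite /translX; case: eqP => // _.
by rewrite /XF sgn3_pos polyFD polyF1.
Qed.

Lemma bdiff_polyF i h : bdiff i (polyF h) = polyF (- diff i neg3 h).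
Proof.
rewrite /bdiff /hop_op opprB polyFB; congr (_ - _).
rewrite -[RHS](@substF_polyF _ _ _ (translX i (opp3 neg3))); last exact: translK.
congr substF; apply/funext => j; rewrite /translX; case: eqP => // _.
by rewrite /XF sgn3_neg polyFB polyF1.
Qed.

Lemma ppartE nu i : ppart nu i = (nu i == pos3).
Proof. by rewrite /ppart /sval3; elim/sign3P: (nu i). Qed.

Lemma npartE nu i : npart nu i = (nu i == neg3).
Proof. by rewrite /npart /sval3; elim/sign3P: (nu i). Qed.

Lemma sval3_eq0 nu i : (sval3 nu i == 0) = (nu i == nul3).
Proof. by rewrite /sval3; elim/sign3P: (nu i). Qed.

Definition only (s : 'I_3) nu i h := if nu i == s then diff i s h else h.

Lemma only_comm s u nu i j h : only s nu i (only u nu j h)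
    = only u nu j (only s nu i h).
Proof.
rewrite /only; case: (nu i == s); case: (nu j == u);
  [exact: diff_comm|exact: erefl|exact: erefl|exact: erefl].
Qed.

Lemma only_split nu i h : diff i (nu i) h = only pos3 nu i (only neg3 nu i h).
Proof. by rewrite /only; elim/sign3P: (nu i) => //=. Qed.

Lemma foldr_only nu s h :
  foldr (only pos3 nu) (foldr (only neg3 nu) h s) s = chain_op diff nu s h.
Proof.
rewrite foldr_foldr; [|exact: only_comm|exact: only_comm|exact: only_comm].
elim: s h => [|i s IH] h; first exact: erefl.
by rewrite [RHS]/= -IH only_split.
Qed.

Lemma diffN i c h : diff i c (- h) = - diff i c h.
Proof. by rewrite /hop_op; case: ifP => // _; rewrite raddfN /= opprD. Qed.

Lemma diff_sign i c k h : diff i c ((-1) ^+ k * h) = (-1) ^+ k * diff i c h.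
Proof. by elim: k => [|k IH]; rewrite ?mul1r // exprS !mulN1r !mulNr diffN IH. Qed.

Lemma multipow_diff nu f :
  multipow fdiff (ppart nu) (multipow bdiff (npart nu) (polyF f))
  = (-1) ^+ (\sum_i npart nu i) * polyF (chain_op diff nu (enum 'I_p) f).
Proof.
have bd s : foldr (fun i => iter (npart nu i) (bdiff i)) (polyF f) s
    = polyF ((-1) ^+ (\sum_(i <- s) npart nu i) * foldr (only neg3 nu) f s).
  elim: s => [|i s IH] /=; first by rewrite big_nil mul1r.
  rewrite IH big_cons npartE /only; case: eqP => _ /=; last by rewrite add0n.
  by rewrite bdiff_polyF diff_sign add1n exprS !mulN1r mulNr.
have fd s h k : foldr (fun i => iter (ppart nu i) (fdiff i)) (polyF ((-1) ^+ k * h)) s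
    = polyF ((-1) ^+ k * foldr (only pos3 nu) h s).
  elim: s => [|i s IH] //=.
  rewrite IH ppartE /only; case: eqP => _ //=.
  by rewrite fdiff_polyF diff_sign.
rewrite /multipow bd fd foldr_only polyFM -big_enum /=; congr (_ * _).
by elim: (\sum_(i <- _) _)%N => [|k IH];
  rewrite ?polyF1 // !exprS polyFM IH polyFN polyF1.
Qed.

Definition posnu nu : {ffun 'I_p -> 'I_3} :=
  [ffun i => if nu i == nul3 then nul3 else pos3].

(** Applying the reflections at the negative sites of nu to an
    equivariant family turns its member of index |nu| into that of index nu. *)
Lemma foldr_refl (G : {ffun 'I_p -> 'I_3} -> {mpoly R[p]}) nu :
  (forall i mu, refl b i (G mu) = G (flip i mu)) ->
  foldr (fun i => iter (npart nu i) (mmap (@mpolyC p R) (reflX b i))) (G (posnu nu)) (enum 'I_p)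
  = G nu.
Proof.
move=> HG.
suff aux s : uniq s ->
    foldr (fun i => iter (npart nu i) (mmap (@mpolyC p R) (reflX b i))) (G (posnu nu)) s
    = G [ffun i => if i \in s then nu i else posnu nu i].
  rewrite aux ?enum_uniq //; congr G; apply/ffunP => i.
  by rewrite ffunE mem_enum.
elim: s => [|i s IH] /=; first by move=> _; congr G; apply/ffunP => i;
  rewrite [RHS]ffunE.
case/andP => nis us; rewrite IH // npartE.
case: eqP => [ni|/eqP ni] /=; rewrite ?HG; congr G; apply/ffunP => j.
  rewrite flipE !ffunE inE; have [->|//] := eqVneq j i.
  by rewrite (negPf nis) ni opp3E.
rewrite !ffunE inE; have [->|//] := eqVneq j i.
by rewrite (negPf nis) /=; move: ni; elim/sign3P: (nu i).
Qed.

Lemma multipow_reflF nu (G K : {ffun 'I_p -> 'I_3} -> {mpoly R[p]}) :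
  (forall i mu, refl b i (G mu) = G (flip i mu)) ->
  (forall i mu, refl b i (K mu) = K (flip i mu)) ->
  (forall mu, K mu != 0) ->
  multipow (reflF beta) (npart nu) (polyF (G (posnu nu)) / polyF (K (posnu nu)))
  = polyF (G nu) / polyF (K nu).
Proof.
move=> HG HK K0; rewrite -[in RHS](foldr_refl nu HG) -[in RHS](foldr_refl nu HK).
rewrite /multipow; elim: (enum 'I_p) => //= i s ->.
have nz : foldr (fun i => iter (npart nu i) (mmap (@mpolyC p R) (reflX b i)))
    (K (posnu nu)) s != 0.
  elim: s => //= j s IH; rewrite npartE; case: (nu j == neg3) => //=.
  by apply: contra_neq IH => e; rewrite -[LHS](reflK j) e raddf0.
by rewrite npartE; case: eqP => //= _; rewrite reflF_frac.
Qed.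

Definition denfac i c : {mpoly R[p]} :=
  if c == nul3 then 1 else sgn3 c * linP b i * hopfac b i c.
Definition denP nu : {mpoly R[p]} := \prod_(i <- enum 'I_p) denfac i (nu i).

Lemma refl_denP i nu : refl b i (denP nu) = denP (flip i nu).
Proof.
rewrite rmorph_prod; apply: eq_bigr => j _ /=; rewrite flipE /denfac.
have -> : ((if j == i then opp3 (nu j) else nu j) == nul3) = (nu j == nul3).
  by case: (j == i); rewrite ?opp3_eq0.
case: ifP => _; first by rewrite rmorph1.
rewrite !rmorphM /= rmorph_sgn3 refl_hopfac; congr (_ * _).
have [->|nji] := eqVneq j i; last by rewrite refl_linP_neq.
by rewrite refl_linP sgn3_opp mulrN mulNr.
Qed.

Lemma denP_neq0 nu : denP nu != 0.
Proof.
rewrite prodf_seq_neq0; apply/allP => i _; rewrite /= /denfac.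
have [_|c0] := eqVneq (nu i) nul3; first exact: oner_neq0.
rewrite !mulf_neq0 ?linP_neq0 ?hopfac_neq0 //.
by apply: contraTneq (oner_neq0 {mpoly R[p]}) => e; rewrite -(sgn3_sqr c0) e mul0r eqxx.
Qed.

(** The common denominator prod_i (2 x_i + beta_i), completed by
    the factors hopfac that the difference provides, exceeds the denominator of
    A_nu by the factors sgnfac. *)
Lemma denP_split nu :
  (\prod_(i <- enum 'I_p) linP b i) * \prod_(i <- enum 'I_p) hopfac b i (nu i)
  = denP nu * \prod_(i <- enum 'I_p) sgnfac b i (nu i).
Proof.
rewrite -!big_split; apply: eq_bigr => i _ /=.
rewrite /denfac /hopfac /sgnfac; case: ifP => [_|/negbT c0]; first by rewrite mulrC.
rewrite -[LHS]mul1r -(sgn3_sqr c0); ring.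
Qed.

End Bridge.

Lemma term_identity (F : fieldType) (D K S E A G sg h k : F) :
  E != 0 -> D * K = E * S -> sg * sg = 1 -> k * h = 1 ->
  k * D * (sg * (h * A / E) * (sg * (K * G))) = A * G * S.
Proof.
move=> E0 DK sg2 kh.
rewrite (_ : _ * _ = (k * h) * (sg * sg) * (A * G) * (D * K) / E); last by ring.
by rewrite kh sg2 DK; field.
Qed.

Section Bridge2.
Context {R : realType} {p : nat} (beta : 'I_p.+2 -> R) (N : nat).
Implicit Types (i j : 'I_p) (f g h : {mpoly R[p]}) (nu : {ffun 'I_p -> 'I_3}).
Local Notation b := (pbeta beta).
Local Notation b0 := (bpar beta 0).
Local Notation bN := (bpar beta p.+1).
Local Notation diff := (hop_op (@transl R p)).
Local Notation num_chain := (chain_wt (num_wt b) (num_next b) (num_last bN N)).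
Local Notation numr := (numer b b0 bN N).

Lemma num_chain_filter nu s t :
  num_chain nu s t = num_chain nu [seq i <- s | nu i != nul3] t.
Proof.
elim: s t => [|i s IH] t; first exact: erefl.
rewrite [LHS]/= IH [in RHS]/=; case: ifP => [_|]; first exact: erefl.
by move/negbFE/eqP => e; rewrite /num_wt /num_next e eqxx mul1r.
Qed.

Lemma polyF_bond_pos i (t : 'I_p) :
  polyF (bond pos3 pos3 'X_i (b i)%:MP 'X_t (b t)%:MP)
  = (XF t + XF i + cstF (b t)) * (XF t + XF i + cstF (b t) + 1).
Proof. by rewrite /bond /mirror [LHS]polyFM !polyFD polyF1. Qed.

Lemma polyF_bond_last i :
  polyF (bond pos3 nul3 'X_i (b i)%:MP N%:R bN%:MP)
  = 2 * ((N%:R - XF i) * (N%:R + XF i + cstF bN)).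
Proof. by rewrite /bond /mirror [LHS]polyFM polyFM polyFB !polyFD !polyF_nat. Qed.

Lemma num_chain_cons nu j s t : nu j != nul3 ->
  num_chain nu (j :: s) t
  = bond t.1.1 (nu j) t.1.2 t.2%:MP 'X_j (b j)%:MP * num_chain nu s (nu j, 'X_j, b j).
Proof.
move=> /negPf nj.
have ewt : num_wt b j (nu j) t = bond t.1.1 (nu j) t.1.2 t.2%:MP 'X_j (b j)%:MP.
  by rewrite /num_wt nj.
have enx : num_next b j (nu j) t = (nu j, 'X_j, b j) by rewrite /num_next nj.
by rewrite [LHS]/= ewt enx.
Qed.

Lemma polyF_num_tail nu i t : (forall j, j \in t -> nu j = pos3) ->
  polyF (num_chain nu t (pos3, 'X_i, b i))
  = \prod_(q <- zip (i :: t) t)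
      ((XF q.2 + XF q.1 + cstF (b q.2)) * (XF q.2 + XF q.1 + cstF (b q.2) + 1))
    * (2 * ((N%:R - XF (last i t)) * (N%:R + XF (last i t) + cstF bN))).
Proof.
elim: t i => [|j t IH] i nut.
  by rewrite big_nil mul1r -polyF_bond_last.
have nuj : nu j = pos3 by apply: nut; rewrite inE eqxx.
rewrite num_chain_cons nuj //= big_cons polyFM polyF_bond_pos IH ?mulrA //.
by move=> k kt; apply: nut; rewrite inE kt orbT.
Qed.

(** Reading A_pos along the increasing list of its support gives the
    chain of bonds: the first factor is the bond from x_0 = 0, the last one the
    bond to x_(p+1) = N. *)
Lemma A_posE nu : nonzero nu ->
  2 * A_pos beta N (fun i => ppart nu i + npart nu i)%N
  = polyF (numr (posnu nu)) / polyF (denP beta (posnu nu)).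
Proof.
move=> nz; pose l := [seq i <- enum 'I_p | nu i != nul3].
have el : [seq i <- enum 'I_p | (ppart nu i + npart nu i)%N != 0%N] = l.
  by apply: eq_filter => i; rewrite ppartE npartE; elim/sign3P: (nu i).
have e0 i : (posnu nu i != nul3) = (nu i != nul3) by rewrite ffunE;
  case: (nu i == nul3).
have lpos i : i \in l -> posnu nu i = pos3.
  by rewrite mem_filter ffunE => /andP[/negPf ->].
have eden : polyF (denP beta (posnu nu))
    = \prod_(i <- l) ((2 * XF i + cstF (b i)) * (2 * XF i + cstF (b i) + 1)).
  rewrite /denP polyF_prod /l [RHS]big_filter [RHS]big_mkcond; apply: eq_bigr => i _ /=.
  rewrite /denfac /hopfac ffunE; case: (nu i == nul3) => /=; first exact: polyF1.
  by rewrite sgn3_pos !mul1r /linP polyFM !polyFD !polyFM polyF_nat polyF1.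
have enum_l : polyF (numr (posnu nu)) = polyF (num_chain (posnu nu) l (nul3, 0, b0)).
  by rewrite /polyF /numer num_chain_filter (eq_filter e0).
rewrite enum_l eden /A_pos el.
case El: l => [|i1 t].
  case/existsP: nz => i nui; have : i \in l by rewrite mem_filter nui mem_enum.
  by rewrite El.
have i1pos : posnu nu i1 = pos3 by apply: lpos; rewrite El inE eqxx.
rewrite num_chain_cons i1pos // polyFM polyF_num_tail; last by move=> j jt;
  apply: lpos; rewrite El inE jt orbT.
have -> : polyF (bond nul3 pos3 0 b0%:MP 'X_i1 (b i1)%:MP)
    = (XF i1 + cstF (b i1)) * (XF i1 + cstF (b i1) - cstF b0).
  by rewrite /bond /mirror /= addr0 subr0 polyFM polyFB !polyFD.
rewrite -/(pbeta beta i1); move: (\prod_(q <- _) _) (\prod_(i <- _) _) => P Q.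
rewrite /pbeta; ring.
Qed.

Lemma two_neq0 : (2 : ratfun R p) != 0.
Proof. by rewrite -polyF_nat polyF_eq0 -mpolyC_nat mpolyC_eq0 pnatr_eq0. Qed.

Lemma two_half : 2 * polyF (2^-1)%:MP = 1 :> ratfun R p.
Proof.
by rewrite -[2]polyF_nat -polyFM -mpolyC_nat -mpolyCM mulfV ?pnatr_eq0 //
  mpolyC1 polyF1.
Qed.

Lemma halfE (r : ratfun R p) f g : 2 * r = polyF f / polyF g ->
  r = polyF ((2^-1)%:MP * f) / polyF g.
Proof.
by move=> e; apply: (mulfI two_neq0); rewrite e polyFM !mulrA two_half mul1r.
Qed.

Lemma A_coefE nu : nonzero nu ->
  A_coef beta N nu = polyF ((2^-1)%:MP * numr nu) / polyF (denP beta nu).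
Proof.
move=> nz; rewrite /A_coef (halfE (A_posE nz)).
apply: (@multipow_reflF _ _ beta nu (fun mu => (2^-1)%:MP * numr mu) (denP beta)).
- by move=> i mu; rewrite [LHS]rmorphM /= mmapC refl_numer.
- exact: refl_denP.
- exact: denP_neq0.
Qed.

(** In the summand of index nu the factors hopfac of the
    difference cancel half of the denominator of A_nu, and sgnfac brings the
    rest to the common denominator; the sign (-1)^|nu^-| cancels those of the
    backward differences. *)
Lemma L_op_numerators f (g : {ffun 'I_p -> 'I_3} -> {mpoly R[p]}) :
  (forall nu, chain_op diff nu (enum 'I_p) f
     = (\prod_(i <- enum 'I_p) hopfac b i (nu i)) * g nu) ->
  2 * polyF (\prod_(i <- enum 'I_p) linP b i) * L_op beta N (polyF f)
  = polyF (\sum_(nu | nonzero nu)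
      numr nu * g nu * \prod_(i <- enum 'I_p) sgnfac b i (nu i)).
Proof.
move=> Hg; rewrite /L_op polyF_sum mulr_sumr; apply: eq_big => [nu|nu nz].
  by apply: eq_existsb => i; rewrite sval3_eq0.
have nz' : nonzero nu by move: nz; congr is_true; apply: eq_existsb => i;
  rewrite sval3_eq0.
rewrite multipow_diff Hg (A_coefE nz').
set sg := (-1) ^+ _; have sg2 : sg * sg = 1 by rewrite -expr2 sqrr_sign.
have two2 := two_half.
have dn0 : polyF (denP beta nu) != 0 by rewrite polyF_eq0 denP_neq0.
have := congr1 (@polyF R p) (denP_split beta nu); rewrite !polyFM => DK.
exact: term_identity dn0 DK sg2 two2.
Qed.

End Bridge2.

(** * Values at lattice points *)

Lemma weight_identity (A : comNzRingType) (w D K E S g : A) :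
  D * K = E * S -> w * E * g * S = D * (w * (K * g)).
Proof. by move=> DK; rewrite mulrCA [D * (K * g)]mulrA DK; ring. Qed.

Section Evaluation.
Context {R : realType} {p : nat} (beta : 'I_p.+2 -> R) (N : nat).
Implicit Types (i j : 'I_p) (f g h : {mpoly R[p]}) (nu : {ffun 'I_p -> 'I_3}).
Variable X : 'I_p -> nat.
Local Notation b := (pbeta beta).
Local Notation b0 := (bpar beta 0).
Local Notation bN := (bpar beta p.+1).
Local Notation diff := (hop_op (@transl R p)).
Local Notation num_chain := (chain_wt (num_wt b) (num_next b) (num_last bN N)).
Local Notation numr := (numer b b0 bN N).
Local Notation x := (fun i : 'I_p => (X i)%:R : R).
Local Notation site := ('I_3 * nat * R)%type.
Local Notation hop_chain :=
  (chain_wt (hop_wt X b) (hop_next X b) (site_last N bN)).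
Local Notation step_chain :=
  (chain_wt (step_wt X b) (step_next X b) (site_last N bN)).

Definition step_coef nu : R := step_chain nu (enum 'I_p) ((nul3, 0%N, b0) : site).

Hypothesis regular : forall i,
  (2 * (X i)%:R + b i != 0) && (2 * (X i)%:R + b i + 1 != 0)
  && ((0 < X i)%N ==> (2 * (X i)%:R + b i - 1 != 0)).

Lemma meval_sgn3 c (v : 'I_p -> R) : (sgn3 c : {mpoly R[p]}).@[v] = sgn3 c.
Proof. exact: (rmorph_sgn3 (meval v)). Qed.

Lemma meval_bond a c y e z e' (v : 'I_p -> R) :
  (bond a c y e z e' : {mpoly R[p]}).@[v] = bond a c y.@[v] e.@[v] z.@[v] e'.@[v].
Proof. exact: (rmorph_bond (meval v)). Qed.

Lemma meval_linP i (v : 'I_p -> R) : (linP b i).@[v] = 2 * v i + b i.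
Proof. by rewrite mevalD mevalM mevalXU mevalC (rmorph_nat (meval v)). Qed.

Lemma meval_denfac i c : c != nul3 ->
  (denfac beta i c).@[x] = denom c (X i)%:R (b i).
Proof.
move=> /negPf c0; rewrite /denfac /hopfac c0 mevalM (mevalD _ (sgn3 c * linP b i) 1).
rewrite !(mevalM _ (sgn3 c) (linP b i)) meval1 meval_sgn3 meval_linP /denom c0;
  move: c0; elim/sign3P: c => // _.
  by rewrite sgn3_neg /mirror /=; ring.
by rewrite sgn3_pos /mirror /=; ring.
Qed.

Lemma denom_neq0 i c : c != nul3 -> ~~ ((X i == 0%N) && (c == neg3)) ->
  denom c (X i)%:R (b i) != 0.
Proof.
move=> c0 good; have /andP[/andP[h1 h2] h3] := regular i.
move: good c0; elim/sign3P: c => // good _; rewrite /denom /mirror /=.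
  move: good h3; rewrite andbT -lt0n => -> /= h3.
  rewrite (_ : _ * _ = (2 * (X i)%:R + b i) * (2 * (X i)%:R + b i - 1)); last by ring.
  by rewrite mulf_neq0.
by rewrite mulf_neq0.
Qed.

Lemma num_chain_nul nu i s t : nu i = nul3 ->
  num_chain nu (i :: s) t = num_chain nu s t.
Proof.
move=> nui.
have ewt : num_wt b i (nu i) t = 1 by rewrite /num_wt nui.
have enx : num_next b i (nu i) t = t by rewrite /num_next nui.
by rewrite [LHS]/= ewt enx mul1r.
Qed.

Lemma hop_chain_nul nu i s u : nu i = nul3 ->
  hop_chain nu (i :: s) u = hop_chain nu s u.
Proof.
move=> nui.
have ewt : hop_wt X b i (nu i) u = 1 by rewrite /hop_wt nui.
have enx : hop_next X b i (nu i) u = u by rewrite /hop_next nui.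
by rewrite [LHS]/= ewt enx mul1r.
Qed.

Lemma hop_chain_cons nu i s u : nu i != nul3 ->
  hop_chain nu (i :: s) u
  = hop u ((nu i, X i, b i) : site) * hop_chain nu s ((nu i, X i, b i) : site).
Proof.
move=> /negPf nui.
have ewt : hop_wt X b i (nu i) u = hop u ((nu i, X i, b i) : site).
  by rewrite /hop_wt nui.
have enx : hop_next X b i (nu i) u = ((nu i, X i, b i) : site).
  by rewrite /hop_next nui.
by rewrite [LHS]/= ewt enx.
Qed.

(** Holds without assuming nonzero denominators: where one of
    them vanishes, so does the numerator, by bond_neg0. *)
Lemma meval_num_chain nu s (t : 'I_3 * {mpoly R[p]} * R) (u : site) :
  t.1.1 = u.1.1 -> t.1.2.@[x] = u.1.2%:R -> t.2 = u.2 ->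
  admissible u -> path leq u.1.2 (map X s) ->
  (num_chain nu s t).@[x]
  = hop_chain nu s u * (\prod_(i <- s) denfac beta i (nu i)).@[x].
Proof.
elim: s t u => [|i s IH] t u e1 e2 e3 ok.
  move=> _; rewrite big_nil meval1 mulr1 [num_chain _ _ _]/= [hop_chain _ _ _]/=.
  rewrite /num_last /site_last meval_bond !mevalC.
  by rewrite (rmorph_nat (meval x)) e1 e2 e3.
case/andP => le_ui pth; rewrite big_cons (mevalM _ (denfac _ _ _)).
have pth' : path leq u.1.2 (map X s).
  exact: path_le leq_trans _ _ _ le_ui pth.
have [nui|nui] := eqVneq (nu i) nul3.
  rewrite num_chain_nul // hop_chain_nul //.
  by rewrite /denfac nui eqxx meval1 mul1r; apply: IH.
rewrite num_chain_cons // (mevalM _ (bond _ _ _ _ _ _)).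
rewrite hop_chain_cons // meval_denfac // meval_bond !mevalC mevalXU e1 e2 e3.
have [/andP[/eqP xi0 /eqP nneg]|good] := boolP ((X i == 0)%N && (nu i == neg3)).
  by rewrite nneg /hop /= (@bond_neg0 _ _ X b i u) // !mul0r.
have ok' : admissible ((nu i, X i, b i) : site).
  by rewrite /admissible /=; move: good; rewrite negb_and -implybE.
rewrite (IH (nu i, 'X_i, b i) ((nu i, X i, b i) : site)) ?mevalXU //.
by rewrite mulrACA /hop /= divfK ?denom_neq0.
Qed.

Lemma meval_chain_transl nu s h (v : 'I_p -> R) : uniq s ->
  (chain_op (fun i c => @transl R p i c) nu s h).@[v]
  = h.@[fun j => v j + (if j \in s then sgn3 (nu j) else 0)].
Proof.
elim: s h => [|i s IH] h.
  by move=> _; apply: meval_eq => j; rewrite addr0.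
case/andP => nis us; rewrite [chain_op _ _ _ _]/= IH // [LHS]meval_psub.
apply: meval_eq => j; rewrite translXE mevalD mevalXU inE -addrA; congr (_ + _).
have [->|nji] := eqVneq j i; first by rewrite (negPf nis) add0r meval_sgn3.
by rewrite meval0 addr0.
Qed.

(** The value of 2 L_p f at a point of the lattice, written with
    shifts. The hopping sum over all nu contains the term nu = 0, which is the
    constant multiple of f added on the left. *)
Lemma quotient_eval f (g : {ffun 'I_p -> 'I_3} -> {mpoly R[p]}) Q :
  (forall nu, chain_op diff nu (enum 'I_p) f
     = (\prod_(i <- enum 'I_p) hopfac b i (nu i)) * g nu) ->
  \sum_(nu | nonzero nu) numr nu * g nu * \prod_(i <- enum 'I_p) sgnfac b i (nu i)
    = (\prod_(i <- enum 'I_p) linP b i) * Q ->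
  path leq 0 (map X (enum 'I_p)) ->
  Q.@[x] + bond nul3 nul3 0 b0 N%:R bN * f.@[x]
  = \sum_nu step_coef nu * f.@[fun i => (X i)%:R + sgn3 (nu i)].
Proof.
move=> Hg HQ pth.
have ok0 : admissible ((nul3, 0%N, b0) : site) by [].
have D0 : (\prod_(i <- enum 'I_p) linP b i).@[x] != 0.
  rewrite (rmorph_prod (meval x)) prodf_seq_neq0; apply/allP => i _ /=.
  by rewrite meval_linP; have /andP[/andP[]] := regular i.
have HQx : Q.@[x] = \sum_(nu | nonzero nu)
    hop_chain nu (enum 'I_p) ((nul3, 0%N, b0) : site)
    * (chain_op diff nu (enum 'I_p) f).@[x].
  apply: (mulfI D0); rewrite -[LHS](mevalM x) -HQ (raddf_sum (meval x)) mulr_sumr.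
  apply: eq_bigr => nu _;
    rewrite Hg -[LHS]/((numr nu * g nu * \prod_(i <- enum 'I_p) sgnfac b i (nu i)).@[x]).
  rewrite (mevalM x (numr nu * g nu)) (mevalM x (numr nu)) (mevalM x _ (g nu)).
  have -> : (numr nu).@[x]
      = hop_chain nu (enum 'I_p) ((nul3, 0%N, b0) : site) * (denP beta nu).@[x].
    by apply: meval_num_chain; rewrite ?meval0.
  have := congr1 (meval x) (denP_split beta nu); rewrite !(mevalM x).
  exact: weight_identity.
have Efull nu : supported (enum 'I_p) nu.
  by apply/forallP => j; rewrite mem_enum.
have := @step_sumE _ _ _ X b N bN (fun i c => @transl R p i c) (meval x)
  (@transl_nul R p) regular (enum 'I_p) ((nul3, 0%N, b0) : site) f ok0 pth.
rewrite !chain_sumE ?enum_uniq // => e.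
(* The term of index 0 of the hopping sum is split off. *)
transitivity (\sum_(nu | supported (enum 'I_p) nu)
    hop_chain nu (enum 'I_p) ((nul3, 0%N, b0) : site)
    * (chain_op diff nu (enum 'I_p) f).@[x]).
  rewrite (eq_bigl predT) // HQx [RHS](bigD1 [ffun=> nul3]) //= addrC; congr (_ + _);
    last first.
    have chain0 s u : hop_chain [ffun=> nul3] s u = site_last N bN u.
      by elim: s u => // i s IH u; rewrite hop_chain_nul ?ffunE.
    have op0 s h : chain_op diff [ffun=> nul3] s h = h.
      by elim: s h => // i s IH h; rewrite [LHS]/= IH /hop_op ffunE eqxx.
    congr (_ * _); first exact/esym/chain0.
    by congr (meval _ _); apply/esym/op0.
  apply: eq_bigl => nu; apply/existsP/idP => [[i]|].
    by apply: contra_neq => ->; rewrite ffunE.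
  move=> nz; apply/existsP; apply: contraNT nz; rewrite negb_exists => /forallP nz.
  apply/eqP/ffunP => i; rewrite ffunE; have := nz i; rewrite negbK => /eqP //.
rewrite -e (eq_bigl predT) //; apply: eq_bigr => nu _; congr (_ * _).
apply: etrans (meval_chain_transl nu f x (enum_uniq 'I_p)) _; apply: meval_eq => i.
by rewrite mem_enum.
Qed.

End Evaluation.

(** * The functional equation of Gamma *)

Section GammaFunction.
Local Open Scope classical_set_scope.
Local Open Scope ring_scope.
Context {R : realType}.
Implicit Types z : R.

Definition gauss z (n : nat) : R :=
  n`!%:R * powR n%:R z / \prod_(k < n.+1) (z + k%:R).

Lemma Gamma0 : Gamma (0 : R) = 0.
Proof.
apply: (@cvg_lim) => //; rewrite [X in X @ \oo](_ : _ = fun=> 0); first exact: cvg_cst.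
by apply/funext => n; rewrite big_ord_recl /= addr0 mul0r invr0 mulr0.
Qed.

(** Dropping the first term of the sequence does not change its
    limit, convergent or not. *)
Lemma Gamma_shift z : Gamma z = lim ((fun n => gauss z n.+1) @ \oo).
Proof.
rewrite /Gamma; congr get; apply/funext => l; apply/propext.
have e := cvg_shiftS (gauss z) (nbhs l).
by split=> H; [move: H; rewrite -/(gauss z) -e|rewrite -/(gauss z) -e].
Qed.

Definition gauss_ratio z (n : nat) : R := z / (1 + (z + 1) * harmonic n).

Lemma cvg_gauss_ratio z : gauss_ratio z @ \oo --> z.
Proof.
have h1 : (fun n => 1 + (z + 1) * harmonic n) @ \oo --> (1 : R) + (z + 1) * 0.
  by apply: cvgD; [exact: cvg_cst|apply: cvgMl_tmp; exact: cvg_harmonic].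
rewrite mulr0 addr0 in h1.
have h2 := @cvgMl_tmp _ _ _ _ _ z _ (cvgV (oner_neq0 R) h1).
rewrite invr1 mulr1 in h2; exact: h2.
Qed.

Lemma gauss_succ z n : z != 0 ->
  gauss (z + 1) n.+1 = gauss z n.+1 * gauss_ratio z n.
Proof.
move=> z0; have n0 : n.+1%:R != 0 :> R by rewrite pnatr_eq0.
rewrite /gauss /gauss_ratio powRD; last by rewrite n0 implybT.
rewrite powRr1 //.
(* Both sides are the product of z + k for k <= n + 2. *)
have e : z * \prod_(k < n.+2) (z + 1 + k%:R)
  = \prod_(k < n.+2) (z + k%:R) * (z + n.+2%:R).
  have <- : \prod_(k < n.+3) (z + k%:R) = \prod_(k < n.+2) (z + k%:R) * (z + n.+2%:R).
    by rewrite big_ord_recr.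
  rewrite [RHS]big_ord_recl addr0; congr (_ * _); apply: eq_bigr => k _.
  by rewrite -addrA -[(lift ord0 k : nat)]/(k.+1) -nat1r.
have -> : \prod_(k < n.+2) (z + 1 + k%:R)
    = \prod_(k < n.+2) (z + k%:R) * (z + n.+2%:R) / z by rewrite -e mulrC mulKf.
have -> : 1 + (z + 1) * harmonic n = (z + n.+2%:R) / n.+1%:R.
  rewrite /harmonic /= -[n.+2]addn1 natrD (addrCA z) (mulrDl n.+1%:R) divff //.
rewrite !invfM !invrK; move: (\prod_(_ < _) _)^-1 (z + _)^-1 => A B.
ring.
Qed.

(** Gauss's sequences at z + 1 and at z differ by a factor that tends to
    z, which is nonzero. So they converge together, with proportional limits,
    or diverge together, and then both limits are 0 by convention. *)
Lemma GammaS z : z != 0 -> Gamma (z + 1) = z * Gamma z.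
Proof.
move=> z0; rewrite !Gamma_shift.
have -> : (fun n => gauss (z + 1) n.+1) = (fun n => gauss z n.+1 * gauss_ratio z n).
  by apply/funext => n; rewrite gauss_succ.
have ratio : gauss_ratio z @ \oo --> z := @cvg_gauss_ratio z;
  set u := fun n => gauss z n.+1.
have [cu|ncu] := pselect (cvg (u @ \oo)).
  by rewrite mulrC; apply: cvg_lim => //; apply: cvgM.
rewrite [in RHS](_ : lim (u @ \oo) = 0) ?mulr0; last by rewrite (dvgP ncu).
apply: dvgP => cv; apply: ncu.
have ratio0 : \forall t \near \oo, gauss_ratio z t != 0.
  exact: cvgr_neq0 ratio z0.
apply: (@cvgP _ _ (lim ((fun n => u n * gauss_ratio z n) @ \oo) * z^-1)).
apply: cvg_trans (cvgM cv (cvgV z0 ratio)); apply: near_eq_cvg; near=> n.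
by rewrite /= mulfK //; near: n.
Unshelve. all: by end_near. Qed.

End GammaFunction.

(** * Detailed balance *)

Section LocalBalance.
Context {R : realType}.
Local Notation site := ('I_3 * nat * R)%type.
Implicit Types (t u v w : site) (a c : 'I_3) (y z : nat).

Definition rho_factor y (b : R) z (b' : R) : R :=
  Gamma (b' - b + z%:R - y%:R) * Gamma (b' + z%:R + y%:R)
  / ((z - y)`!%:R * Gamma (b + 1 + z%:R + y%:R)).

Lemma rho_factor_neq0 y b z b' : rho_factor y b z b' != 0 ->
  [/\ Gamma (b' - b + z%:R - y%:R) != 0, Gamma (b' + z%:R + y%:R) != 0
    & Gamma (b + 1 + z%:R + y%:R) != 0].
Proof.
by rewrite /rho_factor mulf_eq0 invr_eq0 !mulf_eq0 !negb_or => /andP[/andP[-> ->]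
  /andP[_ ->]].
Qed.

Lemma Gamma_arg_neq0 (z : R) : Gamma z != 0 -> z != 0.
Proof. by apply: contra_neq => ->; apply: Gamma0. Qed.

Lemma Gamma_succ (z w : R) : Gamma z != 0 -> w = z + 1 ->
  [/\ Gamma w = z * Gamma z, z != 0 & Gamma w != 0].
Proof.
move=> Gz ->; have z0 := Gamma_arg_neq0 Gz.
by rewrite GammaS //; split=> //; rewrite mulf_neq0.
Qed.

(** This case and the next three are the elementary moves; the
    others are obtained by reading them backwards. *)
Lemma rho_factor_right y b z b' : (y <= z)%N -> rho_factor y b z b' != 0 ->
  rho_factor y b z b' * bond nul3 pos3 y%:R b z%:R b'
  = rho_factor y b z.+1 b' * bond nul3 neg3 y%:R b z.+1%:R b'.
Proof.
move=> yz /rho_factor_neq0[G1 G2 G3].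
have [e1 _ _] := @Gamma_succ _ (b' - b + z.+1%:R - y%:R) G1 ltac:(rewrite -natr1; ring).
have [e2 _ _] := @Gamma_succ _ (b' + z.+1%:R + y%:R) G2 ltac:(rewrite -natr1; ring).
have [e3 n3 _] := @Gamma_succ _ (b + 1 + z.+1%:R + y%:R) G3 ltac:(rewrite -natr1; ring).
have k0 : (z - y).+1%:R != 0 :> R by rewrite pnatr_eq0.
have f0 : (z - y)`!%:R != 0 :> R by rewrite pnatr_eq0 -lt0n fact_gt0.
have k1 : (z - y).+1%:R = z%:R - y%:R + 1 :> R by rewrite -natr1 natrB.
rewrite /rho_factor e1 e2 e3 subSn // factS natrM /bond /mirror /=.
move: k0; rewrite k1; move: (Gamma _) (Gamma _) (Gamma _) G1 G2 G3 (_`!%:R) f0 n3.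
move=> A B C A0 B0 C0 F F0 n3 k0; rewrite -(natr1 z).
by field; rewrite k0 F0 C0 n3.
Qed.

Lemma rho_factor_left y b z b' : (y < z)%N -> rho_factor y b z b' != 0 ->
    rho_factor y.+1 b z b' != 0 ->
  rho_factor y b z b' * bond pos3 nul3 y%:R b z%:R b'
  = rho_factor y.+1 b z b' * bond neg3 nul3 y.+1%:R b z%:R b'.
Proof.
move=> yz /rho_factor_neq0[_ G2 G3] /rho_factor_neq0[G1 _ _].
have [e1 n1 _] := @Gamma_succ _ (b' - b + z%:R - y%:R) G1 ltac:(rewrite -natr1; ring).
have [e2 _ _] := @Gamma_succ _ (b' + z%:R + y.+1%:R) G2 ltac:(rewrite -natr1; ring).
have [e3 n3 _] := @Gamma_succ _ (b + 1 + z%:R + y.+1%:R) G3 ltac:(rewrite -natr1; ring).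
have k1 : (z - y.+1).+1%:R = z%:R - y%:R :> R by rewrite subnSK // natrB // ltnW.
have k0 : (z - y.+1).+1%:R != 0 :> R by rewrite pnatr_eq0.
have f0 : (z - y.+1)`!%:R != 0 :> R by rewrite pnatr_eq0 -lt0n fact_gt0.
rewrite /rho_factor e1 e2 e3 -(subnSK yz) factS natrM /bond /mirror /=.
move: k0; rewrite k1.
move: (Gamma _) (Gamma _) (Gamma _) G1 G2 G3 (_`!%:R) f0 n3 n1.
move=> A B C A0 B0 C0 F F0 n3 n1 k0; rewrite -(natr1 y).
by field; rewrite k0 F0 C0 n3.
Qed.

Lemma rho_factor_both y b z b' : (y <= z)%N -> rho_factor y b z b' != 0 ->
  rho_factor y b z b' * bond pos3 pos3 y%:R b z%:R b'
  = rho_factor y.+1 b z.+1 b' * bond neg3 neg3 y.+1%:R b z.+1%:R b'.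
Proof.
move=> yz /rho_factor_neq0[G1 G2 G3].
have [e2 _ m2] := @Gamma_succ _ (b' + z%:R + y%:R + 1) G2 erefl.
have [e2' _ _] := @Gamma_succ _ (b' + z.+1%:R + y.+1%:R) m2 ltac:(rewrite -!natr1;
  ring).
have [e3 n3 m3] := @Gamma_succ _ (b + 1 + z%:R + y%:R + 1) G3 erefl.
have [e3' n3' _] := @Gamma_succ _ (b + 1 + z.+1%:R
  + y.+1%:R) m3 ltac:(rewrite -!natr1; ring).
have -> : rho_factor y.+1 b z.+1 b'
  = Gamma (b' - b + z%:R - y%:R) * Gamma (b' + z.+1%:R + y.+1%:R)
  / ((z - y)`!%:R * Gamma (b + 1 + z.+1%:R + y.+1%:R)).
  by rewrite /rho_factor subSS; congr (Gamma _ * _ / _); rewrite -!natr1; ring.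
rewrite /rho_factor e2' e3' e2 e3 /bond /mirror /=.
have f0 : (z - y)`!%:R != 0 :> R by rewrite pnatr_eq0 -lt0n fact_gt0.
move: (Gamma _) (Gamma _) (Gamma _) G1 G2 G3 (_`!%:R) f0 n3 n3'.
move=> A B C A0 B0 C0 F F0 n3 n3'; rewrite -!natr1.
by field; rewrite F0 C0 n3 n3'.
Qed.

Lemma rho_factor_cross y b z b' : (y.+1 < z)%N -> rho_factor y b z b' != 0 ->
    rho_factor y.+1 b z.-1 b' != 0 ->
  rho_factor y b z b' * bond pos3 neg3 y%:R b z%:R b'
  = rho_factor y.+1 b z.-1 b' * bond neg3 pos3 y.+1%:R b z.-1%:R b'.
Proof.
case: z => // z; rewrite ltnS [z.+1.-1]/= => yz /rho_factor_neq0[_ G2 G3]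
  /rho_factor_neq0[G1 _ _].
have [e1 _ m1] := @Gamma_succ _ (b' - b + z%:R - y.+1%:R + 1) G1 erefl.
have [e1' _ _] := @Gamma_succ _ (b' - b + z.+1%:R - y%:R) m1 ltac:(rewrite -!natr1;
  ring).
have -> : rho_factor y.+1 b z b'
  = Gamma (b' - b + z%:R - y.+1%:R) * Gamma (b' + z.+1%:R + y%:R)
  / ((z - y.+1)`!%:R * Gamma (b + 1 + z.+1%:R + y%:R)).
  by rewrite /rho_factor; congr (_ * Gamma _ / (_ * Gamma _)); rewrite -!natr1; ring.
rewrite /rho_factor e1' e1 subSn; last by rewrite ltnW.
rewrite -(subnSK yz) !factS !natrM /bond /mirror /=.
have k1 : (z - y.+1).+1%:R = z%:R - y%:R :> R by rewrite subnSK // natrB // ltnW.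
have k2 : (z - y.+1).+2%:R = z%:R - y%:R + 1 :> R by rewrite -natr1 k1.
have k10 : (z - y.+1).+1%:R != 0 :> R by rewrite pnatr_eq0.
have k20 : (z - y.+1).+2%:R != 0 :> R by rewrite pnatr_eq0.
have f0 : (z - y.+1)`!%:R != 0 :> R by rewrite pnatr_eq0 -lt0n fact_gt0.
move: k10 k20; rewrite k2 k1.
move: (Gamma _) (Gamma _) (Gamma _) G1 G2 G3 (_`!%:R) f0.
move=> A B C A0 B0 C0 F F0 k10 k20; rewrite -!natr1.
by field; rewrite k10 k20 F0 C0.
Qed.

Definition adj c y z := (z.+1 == y + c)%N.

Lemma adj_opp c y z : adj c y z -> adj (opp3 c) z y.
Proof. by rewrite /adj; elim/sign3P: c; rewrite opp3E /=; lia. Qed.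

(** Under a move the Gamma quotient of rho changes by exactly
    the ratio of the bonds for the move and for its inverse. *)
Lemma rho_factor_balance a c y z y' z' b b' : adj a y y' -> adj c z z' ->
  (y <= z)%N -> (y' <= z')%N -> rho_factor y b z b' != 0 ->
    rho_factor y' b z' b' != 0 ->
  rho_factor y b z b' * bond a c y%:R b z%:R b'
  = rho_factor y' b z' b' * bond (opp3 a) (opp3 c) y'%:R b z'%:R b'.
Proof.
rewrite /adj; elim/sign3P: a; elim/sign3P: c;
  rewrite !opp3E /= ?addn0 ?addn1 ?addn2 => /eqP ea /eqP ec.
- by rewrite -ea -ec => le le' nz nz'; apply/esym/rho_factor_both.
- by case: ec => <-; rewrite -ea => le le' nz nz'; apply/esym/rho_factor_left.
- case: ec => ->; rewrite -ea => le le' nz nz'; apply/esym.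
  by apply: (@rho_factor_cross y' b z.+1 b').
- by case: ea => <-; rewrite -ec => le le' nz nz'; apply/esym/rho_factor_right.
- by case: ea => <-; case: ec => <-.
- by case: ea => <-; case: ec => -> le le' nz nz'; apply: rho_factor_right.
- case: ea => ->; rewrite -ec => le le' nz nz'.
  by apply: (@rho_factor_cross y b z'.+1 b').
- by case: ea => ->; case: ec => <- le le' nz nz'; apply: rho_factor_left.
- by case: ea => ->; case: ec => -> le le' nz nz'; apply: rho_factor_both.
Qed.

(** A move that would break the order of two adjacent coordinates
    is forbidden, because its bond has a vanishing factor. *)
Lemma bond_vanish a c y z b b' : (y <= z)%N -> (z + c < y + a)%N ->
  bond a c y%:R b z%:R b' = 0 :> R.
Proof.
elim/sign3P: a; elim/sign3P: c; rewrite /bond /mirror /= => le lt; try lia.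
- have -> : z = y by lia.
  ring.
- have [->|->] : z = y \/ z = y.+1 by lia.
    ring.
  rewrite -natr1; ring.
- have -> : z = y by lia.
  ring.
Qed.

(** The factor beta_k + 2 x_k of rho, which balances the denominator
    of the shift coefficients at the site k. *)
Definition rho_point t : R := t.2 + 2 * t.1.2%:R.
Definition rho_link t u : R := rho_factor t.1.2 t.2 u.1.2 u.2.

Definition moved t u := adj t.1.1 t.1.2 u.1.2 && (u.1.1 == opp3 t.1.1) && (u.2 == t.2).

Lemma denom_balance t u : moved t u -> rho_point t != 0 -> rho_point u != 0 ->
  rho_point t / denom t.1.1 t.1.2%:R t.2 = rho_point u / denom u.1.1 u.1.2%:R u.2.
Proof.
move: t u => [[a y] b] [[a' y'] b']; rewrite /moved /rho_point /denom /=.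
case/andP=> /andP[+ /eqP ->] /eqP ->; rewrite /adj.
elim/sign3P: a; rewrite opp3E /= /mirror /= ?addn0 ?addn1 ?addn2 => /eqP e.
- rewrite -e => n1 n2.
  rewrite (_ : (2 * _ + b) * _ = (b + 2 * y'.+1%:R) * (b + 2 * y'.+1%:R - 1));
    last by ring.
  rewrite (_ : (2 * _ + b) * _ = (b + 2 * y'%:R) * (b + 2 * y'%:R + 1)); last by ring.
  by rewrite !invfM !mulVKf // -natr1; congr _^-1; ring.
- by case: e => ->.
- case: e => -> n1 n2.
  rewrite (_ : (2 * _ + b) * _ = (b + 2 * y%:R) * (b + 2 * y%:R + 1)); last by ring.
  rewrite (_ : (2 * _ + b) * _ = (b + 2 * y.+1%:R) * (b + 2 * y.+1%:R - 1));
    last by ring.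
  by rewrite !invfM !mulVKf // -natr1; congr _^-1; ring.
Qed.

(** Away from the corner this combines the balance of bonds and of
    denominators; in the corner the sign is 0 and nothing moves. *)
Lemma step_balance t u t' u' : moved t t' -> moved u u' ->
  (t.1.2 <= u.1.2)%N -> (t'.1.2 <= u'.1.2)%N ->
  rho_link t u != 0 -> rho_link t' u' != 0 -> rho_point u != 0 -> rho_point u' != 0 ->
  rho_link t u * (rho_point u * step t u)
    = rho_link t' u' * (rho_point u' * step t' u').
Proof.
move=> mt mu le le' g0 g0' u0 u0'.
have hop_bal : rho_link t u * (rho_point u * hop t u)
  = rho_link t' u' * (rho_point u' * hop t' u').
  move: (mt) (mu) => /andP[/andP[at_ /eqP et1] /eqP et2] /andP[/andP[au /eqP eu1]
    /eqP eu2].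
  have swap (A S B D : R) : A * (S * (B / D)) = (A * B) * (S / D) by ring.
  rewrite /hop !swap (denom_balance mu u0 u0'); congr (_ * _).
  move: g0'; rewrite /rho_link et2 eu2 => g0'.
  by rewrite (rho_factor_balance at_ au le le' g0 g0') et1 eu1.
rewrite /step; case: ifP => [deg|ndeg]; last first.
  rewrite ifF ?hop_bal //; apply: contraFF ndeg.
  move: mu => /andP[/andP[ad /eqP et] _] /andP[/eqP x0]; rewrite et.
  move: ad; rewrite /adj x0; elim/sign3P: (u.1.1); rewrite opp3E //= => /eqP.
    by rewrite addn1 => -[<-].
  by rewrite addn2.
have [ut ux] : u.1.1 = nul3 /\ u.1.2 = 0%N.
  move: mu deg => /andP[/andP[ad _] _] /andP[/eqP x0]; move: ad; rewrite /adj x0.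
  by elim/sign3P: (u.1.1).
have ux' : u'.1.2 = 0%N.
  by move: mu => /andP[/andP[+ _] _]; rewrite /adj ut ux /= => /eqP[].
have ut' : u'.1.1 = nul3 by move: mu => /andP[/andP[_ /eqP ->] _]; rewrite ut opp3E.
have tx : t.1.2 = 0%N by move: le; rewrite ux leqn0 => /eqP.
have tx' : t'.1.2 = 0%N by move: le'; rewrite ux' leqn0 => /eqP.
have tst : t.1.1 = nul3.
  move: mt => /andP[/andP[+ _] _]; rewrite /adj tx tx'.
  by elim/sign3P: (t.1.1).
have tst' : t'.1.1 = nul3 by move: mt => /andP[/andP[_ /eqP ->] _]; rewrite tst opp3E.
move: mt mu => /andP[_ /eqP et2] /andP[_ /eqP eu2].
by rewrite /rho_link /rho_point ux' ut' tx tx' ux ut tst tst' et2 eu2.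
Qed.

Lemma last_balance t t' N bN : moved t t' ->
  (t.1.2 <= N)%N -> (t'.1.2 <= N)%N ->
  rho_factor t.1.2 t.2 N bN != 0 -> rho_factor t'.1.2 t'.2 N bN != 0 ->
  rho_factor t.1.2 t.2 N bN * site_last N bN t
    = rho_factor t'.1.2 t'.2 N bN * site_last N bN t'.
Proof.
move=> /andP[/andP[at_ /eqP et1] /eqP et2] le le' g0; rewrite et2 => g0'.
have an : adj nul3 N N by rewrite /adj addn1.
by rewrite /site_last (rho_factor_balance at_ an le le' g0 g0') opp3E -et1 et2.
Qed.

Lemma step_vanish t u : (t.1.2 <= u.1.2)%N -> step t u != 0 ->
  (t.1.2 + t.1.1 <= u.1.2 + u.1.1)%N.
Proof.
move=> le; rewrite /step; case: ifP => [/andP[/eqP ux up]|_].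
  case: ifP => [/andP[/eqP -> /eqP ->]|_]; last by rewrite eqxx.
  by rewrite leq_add2r.
rewrite leqNgt /hop; apply: contraNN => lt.
by rewrite bond_vanish // mul0r.
Qed.

Lemma last_vanish t N bN : (t.1.2 <= N)%N -> site_last N bN t != 0 ->
  (t.1.2 + t.1.1 <= N + 1)%N.
Proof.
move=> le; rewrite leqNgt /site_last; apply: contraNN => lt.
by rewrite (@bond_vanish _ nul3).
Qed.

End LocalBalance.

(** * The form as a sum over pairs of lattice points *)

Section Lattice.
Context {R : realType} {p : nat} (beta : 'I_p.+2 -> R) (N : nat).
Local Notation point := {ffun 'I_p -> 'I_N.+1}.
Local Notation site := ('I_3 * nat * R)%type.
Local Notation bN := (bpar beta p.+1).
Local Notation b := (pbeta beta).
Implicit Types (x y : point) (nu : {ffun 'I_p -> 'I_3}) (i : 'I_p).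

Definition state nu (k : nat) : 'I_3 :=
  if k is k'.+1 then (if insub k' is Some i then nu i else nul3) else nul3.

(** Sites are numbered from 0 to p + 1, the two ends being fixed at 0
    and N with sign 0. *)
Definition site_of x nu k : site := (state nu k, xcoord x k, bpar beta k).

Definition shift_coef x nu : R := step_coef beta N (fun i => x i : nat) nu.

Lemma xcoordS x i : xcoord x i.+1 = x i.
Proof. by rewrite /xcoord valK. Qed.

Lemma stateS nu i : state nu i.+1 = nu i.
Proof. by rewrite /state valK. Qed.

Lemma xcoord_last x : xcoord x p.+1 = N.
Proof. by rewrite /xcoord insubF ?ltnn. Qed.

Lemma state_last nu : state nu p.+1 = nul3.
Proof. by rewrite /state insubF ?ltnn. Qed.

Lemma V_N_le x k : x \in V_N N -> (k <= p)%N -> (xcoord x k <= xcoord x k.+1)%N.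
Proof. by rewrite inE => /forallP/(_ (inord k)); rewrite /= => h kp; move: h;
  rewrite inordK. Qed.

Lemma chain_step_prod (X : 'I_p -> nat) nu s t :
  let L := [seq ((nu i, X i, b i) : site) | i <- s] in
  chain_wt (step_wt X b) (step_next X b) (site_last N bN) nu s t
  = (\prod_(0 <= j < size s) step (nth t (t :: L) j) (nth t (t :: L) j.+1))
    * site_last N bN (nth t (t :: L) (size s)).
Proof.
elim: s t => [|i s IH] t L; first by rewrite big_nil mul1r.
rewrite [LHS]/= IH big_nat_recl // -mulrA; congr (_ * _).
rewrite /step_next; congr (_ * site_last _ _ _).
  apply: eq_big_nat => j /andP[_ js]; rewrite /L [map _ _]/=.
  congr step; first by apply: set_nth_default; rewrite /= size_map ltnS ltnW.
  by apply: set_nth_default; rewrite /= size_map ltnS.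
by rewrite /L [map _ _]/=; apply: set_nth_default; rewrite /= size_map ltnS.
Qed.

Lemma shift_coef_prod x nu :
  shift_coef x nu = (\prod_(0 <= k < p) step (site_of x nu k) (site_of x nu k.+1))
    * site_last N bN (site_of x nu p).
Proof.
rewrite /shift_coef /step_coef chain_step_prod size_enum_ord.
set t0 : site := (nul3, 0%N, _); set L := map _ _.
have nthL k : (k <= p)%N -> nth t0 (t0 :: L) k = site_of x nu k.
  case: k => [|k] kp; first by [].
  rewrite [LHS]/= /L (nth_map (Ordinal kp)) ?size_enum_ord //.
  have -> : nth (Ordinal kp) (enum 'I_p) k = Ordinal kp.
    by apply: val_inj; rewrite /= nth_enum_ord.
  by rewrite /site_of -(stateS nu (Ordinal kp)) -(xcoordS x (Ordinal kp)).
rewrite nthL //; congr (_ * _); apply: eq_big_nat => k /andP[_ kp].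
by rewrite !nthL // ltnW.
Qed.

Lemma rho_prod x nu :
  rho beta x = (\prod_(0 <= k < p) (rho_link (site_of x nu k) (site_of x nu k.+1)
                                 * rho_point (site_of x nu k.+1)))
    * rho_factor (xcoord x p) (bpar beta p) N bN.
Proof.
have -> : rho beta x
    = (\prod_(0 <= k < p.+1) rho_factor (xcoord x k) (bpar beta k) (xcoord x k.+1) (bpar beta k.+1))
      * \prod_(1 <= k < p.+1) (bpar beta k + 2 * (xcoord x k)%:R).
  by rewrite /rho big_mkord.
rewrite big_nat_recr // xcoord_last big_add1 [in RHS]big_split /=.
by rewrite mulrAC.
Qed.

Definition opp_state nu : {ffun 'I_p -> 'I_3} := [ffun i => opp3 (nu i)].

Definition step_to nu x y := [forall i, adj (nu i) (x i) (y i)].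

Lemma moved_site x y nu k : step_to nu x y -> (k <= p)%N ->
  moved (site_of x nu k) (site_of y (opp_state nu) k).
Proof.
move=> /forallP xy; case: k => [|k] kp.
  by rewrite /moved /= eqxx.
have -> : k.+1 = (Ordinal kp).+1 by [].
by rewrite /moved /site_of !stateS !xcoordS /opp_state ffunE /= xy !eqxx.
Qed.

Lemma rho_neq0_factors x nu : rho beta x != 0 ->
  [/\ forall k, (k < p)%N -> rho_link (site_of x nu k) (site_of x nu k.+1) != 0,
      forall k, (k < p)%N -> rho_point (site_of x nu k.+1) != 0
    & rho_factor (xcoord x p) (bpar beta p) N bN != 0].
Proof.
rewrite (rho_prod x nu) mulf_eq0 negb_or prodf_seq_neq0 => /andP[/allP nz ->].
split=> // k kp; have := nz k; rewrite mem_index_iota kp => /(_ isT) /=;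
  by rewrite mulf_eq0 negb_or => /andP[].
Qed.

(** Both sides are products over the sites, and they agree
    factor by factor. *)
Lemma detailed_balance x y nu : x \in V_N N -> y \in V_N N -> step_to nu x y ->
  rho beta x != 0 -> rho beta y != 0 ->
  rho beta x * shift_coef x nu = rho beta y * shift_coef y (opp_state nu).
Proof.
move=> xV yV xy rx ry.
have [gx sx lx] := rho_neq0_factors nu rx.
have [gy sy ly] := rho_neq0_factors (opp_state nu) ry.
rewrite (rho_prod x nu) (rho_prod y (opp_state nu)) !shift_coef_prod.
rewrite mulrACA [RHS]mulrACA -!big_split; congr (_ * _).
  apply: eq_big_nat => k /andP[_ kp] /=.
  rewrite -(mulrA (rho_link (site_of x nu k) _)) -(mulrA (rho_link (site_of y _ k) _)).
  exact: (step_balance (moved_site xy (ltnW kp)) (moved_site xy kp)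
    (V_N_le xV (ltnW kp)) (V_N_le yV (ltnW kp)) (gx k kp) (gy k kp) (sx k kp) (sy k kp)).
have lexN (z : point) : z \in V_N N -> (xcoord z p <= N)%N.
  by move=> zV; rewrite -[X in (_ <= X)%N](xcoord_last z) V_N_le.
exact: (last_balance (moved_site xy (leqnn p)) (lexN x xV) (lexN y yV) lx ly).
Qed.

(** If no weight vanishes, the moved coordinates stay in order
    between 0 and N. The quantity h is the moved coordinate plus one, which
    avoids negative numbers. *)
Lemma shift_coef_target x nu : x \in V_N N -> shift_coef x nu != 0 ->
  exists2 y : point, y \in V_N N & step_to nu x y.
Proof.
move=> xV; rewrite shift_coef_prod mulf_eq0 negb_or prodf_seq_neq0 => /andP[/allP nz lz].
have mono k : (k <= p)%N ->
  (xcoord x k + state nu k <= xcoord x k.+1 + state nu k.+1)%N.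
  rewrite leq_eqVlt => /predU1P[->|kp].
    rewrite xcoord_last state_last; apply: last_vanish lz => /=.
    by rewrite -[X in (_ <= X)%N](xcoord_last x) V_N_le.
  have := nz k; rewrite mem_index_iota kp => /(_ isT) /= /step_vanish; apply.
  by rewrite V_N_le // ltnW.
pose h k := (xcoord x k + state nu k)%N.
have hmono j k : (j <= k)%N -> (k <= p.+1)%N -> (h j <= h k)%N.
  elim: k => [|k IH]; first by rewrite leqn0 => /eqP ->.
  rewrite leq_eqVlt => /predU1P[-> //|jk] kp.
  exact: leq_trans (IH jk (ltnW kp)) (mono k kp).
have h1 k : (k <= p.+1)%N -> (1 <= h k)%N by move=> kp;
  apply: leq_trans (hmono 0%N k _ kp).
have hN k : (k <= p.+1)%N -> (h k <= N.+1)%N.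
  move=> kp; apply: leq_trans (hmono k p.+1 kp (leqnn _)) _.
  by rewrite /h xcoord_last state_last /= addn1.
pose y : point := [ffun i : 'I_p => inord (h i.+1).-1].
have hy i : (y i : nat) = (h i.+1).-1.
  rewrite ffunE inordK // ltnS.
  by have := hN i.+1 (ltnW (ltn_ord i)); case: (h _).
have xy k : (k <= p.+1)%N -> xcoord y k = (h k).-1.
  case: k => [|k] kp; first by [].
  move: kp; rewrite ltnS leq_eqVlt => /predU1P[->|kp].
    by rewrite xcoord_last /h xcoord_last state_last addn1.
  have -> : k.+1 = (Ordinal kp).+1 by [].
  by rewrite xcoordS hy.
exists y.
  rewrite inE; apply/forallP => k; have kp : (k <= p)%N by rewrite -ltnS.
  rewrite (xy k (leqW kp)) (xy k.+1 kp); have := hmono k k.+1 (leqnSn _) kp.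
  by rewrite -!subn1; apply: leq_sub2r.
rewrite /step_to; apply/forallP => i; rewrite /adj hy prednK;
  last exact: (h1 i.+1 (ltnW (ltn_ord i))).
by rewrite /h xcoordS stateS.
Qed.

Definition pt x i : R := (x i : nat)%:R.

Lemma step_to_pt x y nu : step_to nu x y -> (fun i => pt x i + sgn3 (nu i)) = pt y.
Proof.
move=> /forallP xy; apply/funext => i; have := xy i; rewrite /adj /pt /sgn3 => /eqP e.
by rewrite addrA -natrD -e -natr1 addrK.
Qed.

Lemma step_to_inj x y z nu : step_to nu x y -> step_to nu x z -> y = z.
Proof.
move=> /forallP xy /forallP xz; apply/ffunP => i; apply: val_inj.
by have := xy i; rewrite /adj -(eqP (xz i)) => /eqP [].
Qed.

Lemma step_to_opp x y nu : step_to (opp_state nu) y x = step_to nu x y.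
Proof.
rewrite /step_to; apply/forallP/forallP => h i; have := adj_opp (h i);
  rewrite ffunE ?opp3K //.
Qed.

Lemma opp_stateK : involutive opp_state.
Proof. by move=> nu; apply/ffunP => i; rewrite !ffunE opp3K. Qed.

(** The form is a sum over pairs of points of V_N. Exchanging
    the two points together with nu |-> - nu preserves the kernel, by
    detailed_balance. *)
Lemma shift_sum_symmetric (F G : ('I_p -> R) -> R) :
  (forall x, x \in V_N N -> rho beta x != 0) ->
  \sum_(x in V_N N) rho beta x * G (pt x)
    * \sum_nu shift_coef x nu * F (fun i => pt x i + sgn3 (nu i))
  = \sum_(x in V_N N) rho beta x * F (pt x)
    * \sum_nu shift_coef x nu * G (fun i => pt x i + sgn3 (nu i)).
Proof.
move=> rho0.
(* A shift that leaves V_N has coefficient 0; any other has one target. *)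
have expand (H K : ('I_p -> R) -> R) :
    \sum_(x in V_N N) rho beta x * K (pt x)
      * \sum_nu shift_coef x nu * H (fun i => pt x i + sgn3 (nu i))
    = \sum_(x in V_N N) \sum_(y in V_N N) \sum_(nu | step_to nu x y)
        rho beta x * shift_coef x nu * (K (pt x) * H (pt y)).
  apply: eq_bigr => x xV; rewrite mulr_sumr.
  under [RHS]eq_bigr => y _ do rewrite big_mkcond.
  rewrite [RHS]exchange_big; apply: eq_bigr => nu _; rewrite -big_mkcondr /=.
  have [c0|c0] := eqVneq (shift_coef x nu) 0.
    by rewrite c0 mul0r mulr0 big1 // => y _; rewrite mulr0 mul0r.
  have [y yV xy] := shift_coef_target xV c0.
  rewrite (big_pred1 y) => [|z]; first by rewrite (step_to_pt xy); ring.
  apply/andP/eqP => [[_ xz]|->]; last by rewrite yV xy.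
  exact: step_to_inj xz xy.
rewrite !expand exchange_big /=; apply: eq_bigr => x xV; apply: eq_bigr => y yV.
rewrite (reindex_inj (can_inj opp_stateK)) /=.
apply: eq_big => [nu|nu]; first by rewrite step_to_opp.
rewrite step_to_opp => xy.
by rewrite -(detailed_balance xV yV xy) ?rho0 // [G _ * _]mulrC.
Qed.

End Lattice.

(** * Consequences of positivity *)

Section InnerProductConsequences.
Context {R : realType} {p : nat} (beta : 'I_p.+2 -> R) (N : nat).
Local Notation point := {ffun 'I_p -> 'I_N.+1}.
Local Notation bN := (bpar beta p.+1).
Local Notation b := (pbeta beta).
Implicit Types (x y : point) (f g : {mpoly R[p]}) (i : 'I_p).

Lemma P_lamD f g : P_lam beta N f -> P_lam beta N g -> P_lam beta N (f + g).
Proof.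
move=> /P_lamE[q qN ->] /P_lamE[r rN ->]; apply/P_lamE; exists (q + r).
  exact: msizeD_leq.
by rewrite mmapD.
Qed.

Lemma P_lamZ a f : P_lam beta N f -> P_lam beta N (a *: f).
Proof.
move=> /P_lamE[q qN ->]; apply/P_lamE; exists (a *: q).
  exact: leq_trans (msizeZ_le _ _) qN.
by rewrite mmapZ /= mul_mpolyC.
Qed.

Lemma P_lam_sum (I : Type) (r : seq I) (P : pred I) (F : I -> {mpoly R[p]}) :
  (forall j, P j -> P_lam beta N (F j)) -> P_lam beta N (\sum_(j <- r | P j) F j).
Proof.
move=> PF; apply: (big_ind (P_lam beta N)) => //; last exact: P_lamD.
by apply/P_lamE; exists 0; rewrite ?msize0 ?mmap0.
Qed.

Lemma P_lamM d e f g : P_lam beta d f -> P_lam beta e g -> P_lam beta (d + e) (f * g).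
Proof.
move=> /P_lamE[q qd ->] /P_lamE[r re ->]; apply/P_lamE; exists (q * r).
  exact: msizeM_leq.
by rewrite [RHS]rmorphM.
Qed.

Lemma P_lam_prod (I : Type) (r : seq I) (P : pred I) (F : I -> {mpoly R[p]})
    (d : I -> nat) :
  (forall j, P j -> P_lam beta (d j) (F j)) ->
  P_lam beta (\sum_(j <- r | P j) d j) (\prod_(j <- r | P j) F j).
Proof.
move=> PF; elim/big_rec2: _ => [|j f e Pj IH]; last exact: P_lamM (PF j Pj) IH.
by apply/P_lamE; exists 1; rewrite ?msize1 // rmorph1.
Qed.

Lemma P_lam_sub i c : P_lam beta 1 (lam beta i - c%:MP).
Proof.
apply/P_lamE; exists ('X_i - c%:MP); last by rewrite mmapB psubX mmapC.
by rewrite msizeD_leq ?msizeN ?msizeX ?mdeg1 // (leq_trans (msizeC_leq _ _)).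
Qed.

Definition lam_at i (n : nat) : R := n%:R * (n%:R + b i).

Lemma meval_lam i x : (lam beta i).@[pt x] = lam_at i (x i).
Proof. by rewrite mevalM mevalD mevalXU mevalC. Qed.

Lemma meval_lam_sub i x c : (lam beta i - c%:MP).@[pt x] = lam_at i (x i) - c.
Proof. by rewrite mevalB meval_lam mevalC. Qed.

Lemma lam_sub_neq0 i c : lam beta i - c%:MP != 0.
Proof.
apply/eqP => e.
have ev (t : R) : t * (t + b i) = c.
  have := congr1 (meval (fun=> t)) e.
  rewrite mevalB mevalM mevalD mevalXU !mevalC ?meval0 => /eqP.
  by rewrite subr_eq0 => /eqP.
have := ev 0; have := ev 1; have := ev 2; lra.
Qed.

Hypothesis hip : is_inner_product_on (P_lam beta N) (racah_ip beta N).

(** Positivity forbids a nonzero element of norm 0. *)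
Lemma vanishing_eq0 f : P_lam beta N f ->
  (forall x, x \in V_N N -> f.@[pt x] * f.@[pt x] * rho beta x = 0) -> f = 0.
Proof.
case: hip => _ _ pos Pf f0; apply/eqP; apply: contraT => nz.
by have := pos f Pf nz; rewrite /racah_ip big1 ?ltxx.
Qed.

(** If lambda_i took the same value at m and n, the product of the
    lambda_i - lambda_i(j) over the N values j <> n would have degree N and
    vanish on V_N. *)
Lemma lam_at_inj i m n : (m <= N)%N -> (n <= N)%N -> lam_at i m = lam_at i n -> m = n.
Proof.
move=> mN nN e; apply/eqP; apply: contraT => mn.
pose n' : 'I_N.+1 := Ordinal (nN : (n < N.+1)%N).
pose m' : 'I_N.+1 := Ordinal (mN : (m < N.+1)%N).
pose f := \prod_(j : 'I_N.+1 | j != n') (lam beta i - (lam_at i j)%:MP).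
suff f0 : f = 0.
  have : f != 0 by rewrite prodf_seq_neq0; apply/allP => j _;
    rewrite lam_sub_neq0 implybT.
  by rewrite f0 eqxx.
apply: vanishing_eq0 => [|x _].
  rewrite (_ : N = \sum_(j : 'I_N.+1 | j != n') 1)%N.
    by apply: P_lam_prod => j _; apply: P_lam_sub.
  by rewrite sum1_card cardC1 card_ord.
suff -> : f.@[pt x] = 0 by rewrite !mul0r.
rewrite (rmorph_prod (meval (pt x))).
have [xn|xn] := eqVneq (x i) n'; last first.
  by rewrite (bigD1 (x i)) //= meval_lam_sub subrr mul0r.
rewrite (bigD1 m') /=; last by rewrite -val_eqE.
by rewrite meval_lam_sub xn -e subrr mul0r.
Qed.

(** A polynomial of degree y_p <= N in the lambdas that is triangular for
    the componentwise order: nonzero at y, and zero at every point of V_N that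
    does not dominate y. *)
Definition stair y : {mpoly R[p]} :=
  \prod_(i < p) \prod_(xcoord y i <= j < y i) (lam beta i - (lam_at i j)%:MP).

Lemma P_lam_stair y : y \in V_N N -> P_lam beta N (stair y).
Proof.
move=> yV; have leN : (xcoord y p <= N)%N.
  by rewrite -[X in (_ <= X)%N](xcoord_last y) V_N_le.
have -> : stair y = stair y * (1 : {mpoly R[p]}) by rewrite mulr1.
rewrite -(subnKC leN); apply: P_lamM; last first.
  by apply/P_lamE; exists 1; rewrite ?msize1 // rmorph1.
have -> : xcoord y p = (\sum_(i < p) \sum_(xcoord y i <= j < y i) 1)%N.
  transitivity (\sum_(0 <= k < p) (xcoord y k.+1 - xcoord y k))%N.
    rewrite telescope_sumn_in //= ?subn0 // => k /ltnW; exact: V_N_le.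
  by rewrite big_mkord; apply: eq_bigr => i _; rewrite sum_nat_const_nat muln1 xcoordS.
by apply: P_lam_prod => i _; apply: P_lam_prod => j _; apply: P_lam_sub.
Qed.

Lemma meval_stair x y :
  (stair y).@[pt x]
  = \prod_(i < p) \prod_(xcoord y i <= j < y i) (lam_at i (x i) - lam_at i j).
Proof.
rewrite /stair (rmorph_prod (meval (pt x))); apply: eq_bigr => i _ /=.
rewrite (rmorph_prod (meval (pt x))); apply: eq_bigr => j _ /=.
exact: meval_lam_sub.
Qed.

Lemma stair_diag y : (stair y).@[pt y] != 0.
Proof.
rewrite meval_stair; apply/prodf_neq0 => i _; rewrite prodf_seq_neq0; apply/allP => j.
rewrite mem_index_iota => /andP[_ jy] /=; rewrite subr_eq0.
have yN : (y i <= N)%N by rewrite -ltnS.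
have jN : (j <= N)%N by apply: leq_trans (ltnW jy) yN.
by apply: contraTneq jy => e; rewrite (lam_at_inj yN jN e) ltnn.
Qed.

(** If the coordinates dominate up to k, then x_(k+1) >= y_k, and
    x_(k+1) < y_(k+1) would make it one of the roots removed at the site
    k + 1. *)
Lemma stair_support x y : x \in V_N N -> (stair y).@[pt x] != 0 ->
  forall i, (y i <= x i)%N.
Proof.
move=> xV; rewrite meval_stair => /prodf_neq0 nz.
suff le k : (k <= p)%N -> (xcoord y k <= xcoord x k)%N.
  by move=> i; rewrite -!xcoordS le.
elim: k => [|k IH] // kp.
have -> : k.+1 = (Ordinal kp).+1 by [].
rewrite !xcoordS leqNgt; apply/negP => lt.
have := nz (Ordinal kp) isT; rewrite prodf_seq_neq0 => /allP/(_ (x (Ordinal kp) : nat)).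
rewrite mem_index_iota lt andbT subrr eqxx /= => /implyP; rewrite implybF -ltnNge /=.
rewrite ltnNge; apply/negP; rewrite negbK.
apply: leq_trans (IH (ltnW kp)) _; rewrite -(xcoordS x (Ordinal kp)).
exact: V_N_le xV (ltnW kp).
Qed.

Definition height y : nat := \sum_(i < p) y i.

Lemma height_lt x y : x != y -> (forall i, (y i <= x i)%N) -> (height y < height x)%N.
Proof.
move=> xy le; rewrite ltn_neqAle leq_sum // andbT.
have [_ eq_sum] := leqif_sum (fun i (_ : predT i) => leqif_eq (le i)).
rewrite /height eq_sum; apply: contraNN xy => /forallP e.
by apply/eqP/ffunP => i; apply/val_inj/esym/eqP/(implyP (e i)).
Qed.

Lemma height_le y : (height y <= p * N)%N.
Proof.
rewrite /height -[X in (_ <= X * _)%N](card_ord p) -sum_nat_const.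
by apply: leq_sum => i _; rewrite -ltnS.
Qed.

(** Inverting the triangular system of the polynomials stair, from
    the largest points downwards. *)
Lemma delta_exists y : y \in V_N N ->
  exists2 f, P_lam beta N f
    & f.@[pt y] != 0 /\ forall x, x \in V_N N -> x != y -> f.@[pt x] = 0.
Proof.
have [n] := ubnP (p * N - height y); elim: n y => // n IH y.
rewrite ltnS => yn yV.
have /choice[g Hg] x : exists g, x \in V_N N -> (height y < height x)%N ->
    [/\ P_lam beta N g, g.@[pt x] != 0
      & forall z, z \in V_N N -> z != x -> g.@[pt z] = 0].
  have [xV|] := boolP (x \in V_N N); last by exists 0.
  have [yx|] := ltnP (height y) (height x); last by exists 0.
  have [|g Pg [gx gz]] := IH x _ xV; last by exists g.
  by apply: leq_trans yn; have := height_le x; lia.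
(* The values of stair y at the points above y are removed one by one. *)
pose f := stair y - \sum_(x in V_N N | (height y < height x)%N)
  ((stair y).@[pt x] / (g x).@[pt x]) *: g x.
have fE z : f.@[pt z] = (stair y).@[pt z]
    - \sum_(x in V_N N | (height y < height x)%N)
        (stair y).@[pt x] / (g x).@[pt x] * (g x).@[pt z].
  rewrite /f mevalB (raddf_sum (meval (pt z))); congr (_ - _).
  by apply: eq_bigr => x _; rewrite /= mevalZ.
exists f.
  rewrite /f -scaleN1r; apply: P_lamD; first exact: P_lam_stair.
  apply/P_lamZ/P_lam_sum => x /andP[xV yx].
  by have [Pg _ _] := Hg x xV yx; apply: P_lamZ.
split.
  rewrite fE big1 ?subr0 ?stair_diag // => x /andP[xV yx].
  have [_ _ gz] := Hg x xV yx; rewrite (gz y) ?mulr0 //.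
  by apply: contraTneq yx => ->; rewrite ltnn.
move=> z zV zy; rewrite fE.
have [yz|zy'] := ltnP (height y) (height z).
  rewrite (bigD1 z) ?zV //= big1 => [|x /andP[/andP[xV yx] xz]].
    by have [_ gz _] := Hg z zV yz; rewrite addr0 divfK ?subrr.
  by have [_ _ gz] := Hg x xV yx; rewrite (gz z) ?mulr0 // eq_sym.
rewrite big1 => [|x /andP[xV yx]].
  rewrite subr0; apply/eqP; apply: contraLR zy' => nz; rewrite -ltnNge.
  exact: height_lt zy (stair_support zV nz).
have [_ _ gz] := Hg x xV yx; rewrite (gz z) ?mulr0 //.
by apply: contraTneq yx => <-; rewrite -leqNgt.
Qed.

(** Otherwise the element of P_lambda^N supported at y would have norm
    0. *)
Lemma rho_neq0 y : y \in V_N N -> rho beta y != 0.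
Proof.
move=> yV; have [f Pf [fy fx]] := delta_exists yV.
apply: contraNneq fy => ry.
suff -> : f = 0 by rewrite meval0.
apply: vanishing_eq0 => // x xV; have [->|xy] := eqVneq x y.
  by rewrite ry mulr0.
by rewrite fx // !mul0r.
Qed.

(** 2 n + b + 1 is the difference of the values of lambda_i at
    n + 1 and n, up to n = N, where it is the argument of a Gamma factor of rho
    at the point with all coordinates N. Likewise 2 n + b is a factor of rho at
    a constant point. *)
Lemma regular_site i (n : nat) : (n <= N)%N ->
  (2 * n%:R + b i != 0) && (2 * n%:R + b i + 1 != 0)
  && ((0 < n)%N ==> (2 * n%:R + b i - 1 != 0)).
Proof.
move=> nN.
have diff m : (m < N)%N -> 2 * m%:R + b i + 1 != 0.
  move=> mN; apply/eqP => e.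
  have : lam_at i m = lam_at i m.+1.
    apply/eqP; rewrite -subr_eq0 -oppr_eq0 opprB; apply/eqP; rewrite -[RHS]e.
    by rewrite /lam_at -natr1; ring.
  by move/(lam_at_inj (ltnW mN) mN)/eqP; rewrite eqn_leq ltnn andbF.
have constV (m : 'I_N.+1) : [ffun _ : 'I_p => m] \in V_N N.
  rewrite inE; apply/forallP => k; rewrite /xcoord.
  have lem (j : nat) : (m <= if insub j is Some i then [ffun _ : 'I_p => m]
    i : nat else N)%N.
    by case: insubP => [? _ _|_]; rewrite ?ffunE // -ltnS.
  case: k => -[|k] kp //=;
    rewrite (insubT (fun j => (j < p)%N) (kp : (k < p)%N)) /= ffunE.
  exact: lem.
have fac (m : 'I_N.+1) := rho_neq0_factors [ffun=> nul3] (rho_neq0 (constV m)).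
apply/andP; split; last first.
  apply/implyP; case: n nN => // n nN _.
  rewrite (_ : _ - 1 = 2 * n%:R + b i + 1); first exact: diff.
  by rewrite -natr1; ring.
apply/andP; split.
  have [_ sx _] := fac (Ordinal (nN : (n < N.+1)%N)).
  by have := sx i (ltn_ord i); rewrite /rho_point /= valK ffunE /= addrC.
move: nN; rewrite leq_eqVlt => /predU1P[->|]; last exact: diff.
have [gx _ gl] := fac ord_max.
have xN k : xcoord [ffun _ : 'I_p => (ord_max : 'I_N.+1)] k.+1 = N.
  by rewrite /xcoord; case: insubP => // ? _ _; rewrite ffunE.
have arg_neq0 b' : rho_factor N (bpar beta i.+1) N b' != 0 -> 2 * N%:R + b i + 1 != 0.
  move=> /rho_factor_neq0[_ _ /Gamma_arg_neq0]; apply: contra_neq => h; rewrite -[RHS]h.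
  by rewrite /pbeta; ring.
have [ip|ip] := ltnP i.+1 p.
  apply: (arg_neq0 (bpar beta i.+2)).
  by have := gx i.+1 ip; rewrite /rho_link /site_of; cbn [fst snd]; rewrite !xN.
have ep : i.+1 = p by apply/eqP; rewrite eqn_leq ip ltn_ord.
have xp : xcoord [ffun _ : 'I_p => (ord_max : 'I_N.+1)] p = N.
  by rewrite -[RHS](xN i); congr xcoord.
have bp : bpar beta i.+1 = bpar beta p by congr bpar.
by apply: (arg_neq0 bN); rewrite bp -[X in rho_factor X]xp.
Qed.

End InnerProductConsequences.

(** * Self-adjointness *)

Section OperatorOnPolynomials.
Context {R : realType} {p : nat} (beta : 'I_p.+2 -> R) (N : nat).
Local Notation point := {ffun 'I_p -> 'I_N.+1}.
Local Notation b := (pbeta beta).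

Lemma V_N_path (x : point) : x \in V_N N ->
  path leq 0 (map (fun i => x i : nat) (enum 'I_p)).
Proof.
move=> xV; apply/(pathP 0%N) => k; rewrite size_map size_enum_ord => kp.
have nthx j (jp : (j < p)%N) :
    nth 0%N (map (fun i => x i : nat) (enum 'I_p)) j = xcoord x j.+1.
  rewrite (nth_map (Ordinal jp)) ?size_enum_ord // [RHS](xcoordS x (Ordinal jp)).
  by congr (nat_of_ord (x _)); apply: val_inj; rewrite /= nth_enum_ord.
rewrite nthx //; case: k kp => [//|k] kp.
rewrite [nth _ _ k.+1]/= nthx ?(ltnW kp) //; exact: V_N_le xV (ltnW kp).
Qed.

Hypothesis hip : is_inner_product_on (P_lam beta N) (racah_ip beta N).

(** The sum over all nu of the shift coefficients, that is, the value
    of the shift sum on the constant polynomial 1, which L_p annihilates. *)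
Definition shift_const : R := bond nul3 nul3 0 (bpar beta 0) N%:R (bpar beta p.+1).

Lemma L_op_P_lam (f : {mpoly R[p]}) : P_lam beta N f ->
  exists Q : {mpoly R[p]},
  [/\ P_lam beta N Q, polyF Q = L_op beta N (polyF f)
    & forall x : point, x \in V_N N ->
      2 * Q.@[pt x]
      = \sum_nu shift_coef beta x nu * f.@[fun i => pt x i + sgn3 (nu i)]
        - shift_const * f.@[pt x]].
Proof.
move=> Pf.
have [g [Q [Hg HQ invQ szQ]]] := operator_polynomial (bpar beta 0) (bpar beta p.+1) N
  (fun i => P_lam_refl i Pf) (P_lam_msize Pf).
have D0 : polyF (\prod_(i <- enum 'I_p) linP b i) != 0.
  by rewrite polyF_eq0 prodf_seq_neq0; apply/allP => i _; rewrite linP_neq0.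
exists (2^-1 *: Q); split.
- by apply/P_lamZ/invariant_P_lam.
- have := L_op_numerators N Hg; rewrite HQ polyFM.
  rewrite -mulrA mulrCA => /(mulfI D0) e.
  apply: (mulfI (two_neq0 (R := R) (p := p))); rewrite e.
  by rewrite -mul_mpolyC polyFM mulrA two_half mul1r.
move=> x xV; rewrite mevalZ mulrA mulfV ?pnatr_eq0 // mul1r.
have := quotient_eval (fun i => regular_site hip i (ltn_ord (x i))) Hg HQ (V_N_path xV).
by move=> <-; rewrite addrK.
Qed.

Lemma L_op_selfadjoint (f g Lf Lg : {mpoly R[p]}) :
  (forall x : point, x \in V_N N ->
    2 * Lf.@[pt x] = \sum_nu shift_coef beta x nu * f.@[fun i => pt x i + sgn3 (nu i)]
      - shift_const * f.@[pt x]) ->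
  (forall x : point, x \in V_N N ->
    2 * Lg.@[pt x] = \sum_nu shift_coef beta x nu * g.@[fun i => pt x i + sgn3 (nu i)]
      - shift_const * g.@[pt x]) ->
  racah_ip beta N Lf g = racah_ip beta N f Lg.
Proof.
move=> HLf HLg; apply: (mulfI (_ : 2 != 0 :> R)); first by rewrite pnatr_eq0.
pose form (u v : {mpoly R[p]}) := \sum_(x in V_N N) rho beta x * v.@[pt x]
  * \sum_nu shift_coef beta x nu * u.@[fun i => pt x i + sgn3 (nu i)].
have expand (u v Lu : {mpoly R[p]}) :
    (forall x : point, x \in V_N N ->
      2 * Lu.@[pt x] = \sum_nu shift_coef beta x nu * u.@[fun i => pt x i + sgn3 (nu i)]
        - shift_const * u.@[pt x]) ->
    2 * \sum_(x in V_N N) Lu.@[pt x] * v.@[pt x] * rho beta x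
    = form u v - shift_const * \sum_(x in V_N N) u.@[pt x] * v.@[pt x] * rho beta x.
  move=> HL; rewrite /form mulr_sumr [shift_const * _]mulr_sumr -sumrB;
    apply: eq_bigr => x xV.
  by rewrite (mulrA 2) (mulrA 2) (HL x xV); move: (\sum_nu _) => S; ring.
have flip_ip (u v : {mpoly R[p]}) :
    racah_ip beta N u v = \sum_(x in V_N N) v.@[pt x] * u.@[pt x] * rho beta x.
  by apply: eq_bigr => x _; congr (_ * _); apply: mulrC.
rewrite [racah_ip beta N f Lg]flip_ip (expand g f Lg HLg) -(flip_ip f g).
rewrite [LHS](expand f g Lf HLf); congr (_ - _).
exact: (shift_sum_symmetric (fun v => f.@[v]) (fun v => g.@[v]) (@rho_neq0 _ _ _ _ hip)).
Qed.

End OperatorOnPolynomials.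

Theorem lemma3p5 (R : realType) (p N : nat) (beta : 'I_p.+2 -> R)
    (hp : (1 <= p)%N)
    (hrho : rho_well_defined beta N)
    (hip : is_inner_product_on (P_lam beta N) (racah_ip beta N))
    (f g : {mpoly R[p]}) (hf : P_lam beta N f) (hg : P_lam beta N g) :
  exists Lf Lg : {mpoly R[p]},
    [/\ P_lam beta N Lf, P_lam beta N Lg,
        polyF Lf = L_op beta N (polyF f), polyF Lg = L_op beta N (polyF g)
      & racah_ip beta N Lf g = racah_ip beta N f Lg].
Proof.
have [Lf [PLf eLf vLf]] := L_op_P_lam hip hf.
have [Lg [PLg eLg vLg]] := L_op_P_lam hip hg.
exists Lf, Lg; split=> //.
apply: (L_op_selfadjoint hip vLf vLg).
Qed.
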